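(* Let $D$ be an integral domain and suppose that there exists a semilocal overring $A$ of $D$ such that $D = \overline{D}\cap A$. Suppose that also $\overline{A}$ is semilocal, with $s$ maximal ideals, and that all the residue fields of $D$ (at maximal ideals) have cardinality at least $s+1$. Let $R' := Kr(\overline{D}) \cap A(t)$. The following assertions hold: (i) For a valuation overring $V$ of $D$, let $\mathfrak{p} = \mathfrak{m}_{V(t)} \cap R'$. Then $R'_{\mathfrak{p}} = (A\cap V)_{\mathfrak{m}_V \cap A}(t)$. Moreover, if $A$ and $V$ have no common proper overrings, then $R'_{\mathfrak{p}} = V(t)$. (ii) For every valuation overring $\mathcal{V}$ of $R'$, there exists a valuation overring $V$ of $D$ such that $\mathcal{V} \supseteq (A\cap V)(t)$. (iii) The localizations of $R'$ at its maximal ideals are Nagata ring extensions of overrings of $D$, i.e. of the form $C(t)$ for some overring $C$ of $D$. (iv) The integral closure of $R'$ is $Kr(\overline{D}) \cap \overline{A}(t)$.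
   Context: An overring of a domain $D$ is a ring between $D$ and its quotient field. The maximal ideal of a local ring $A$ is $\mathfrak{m}_A$. $\overline{D}$ is the integral closure of $D$ in its quotient field. For a domain $A$ and an indeterminate $t$, the Nagata ring is $A(t)=\{f/g : f,g\in A[t],\ c(g)=A\}$, $c(g)$ being the ideal of $A$ generated by the coefficients of $g$. For an integrally closed domain $D$, $Kr(D)=\bigcap_V V(t)$, $V$ ranging over the valuation overrings of $D$ centered on maximal ideals of $D$ (equivalently, over all valuation overrings). ''$A$ and $V$ have no common proper overrings'' means that no ring properly contained in their common quotient field contains both $A$ and $V$. ''Semilocal'' means having finitely many maximal ideals. All rings $D$, $A$, $V$, etc. are assumed to have finite Krull dimension. *)

(* Defs.v *)
From HB Require Import structures.
From mathcomp Require Import all_boot all_order all_algebra.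
From mathcomp Require Import all_classical.

Set Implicit Arguments.
Unset Strict Implicit.
Unset Printing Implicit Defensive.

Import GRing.Theory.
Local Open Scope ring_scope.
Local Open Scope classical_set_scope.

(* Every ring is a subset of an ambient field F (either the quotient field K  *)
(* of the base domain, or K(t) = {fraction {poly K}}), so that overrings,     *)
(* intersections and localizations of domains are again subsets of F.         *)

Section SubsetsOfField.
Variable F : fieldType.
Implicit Types A B D V I J M P S : set F.

Definition is_subring A := GRing.subring_closed (mem A).

Definition quotient_field A : set F :=
  [set x | exists a b, [/\ A a, A b, b != 0 & x = a / b]].

Definition overring D B :=
  [/\ is_subring B, D `<=` B & B `<=` quotient_field D].

Definition is_ideal A I :=
  [/\ I `<=` A, I 0, (forall x y, I x -> I y -> I (x + y))
    & (forall a x, A a -> I x -> I (a * x))].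

Definition prime_ideal A P :=
  [/\ is_ideal A P, ~ P 1
    & forall x y, A x -> A y -> P (x * y) -> P x \/ P y].

Definition maximal_ideal A M :=
  [/\ is_ideal A M, ~ M 1
    & forall J, is_ideal A J -> ~ J 1 -> M `<=` J -> J = M].

Definition maximal_ideals A : set (set F) := [set M | maximal_ideal A M].

Definition semilocal A := finite_set (maximal_ideals A).

(* Only meant for local A, where the union is that of a single ideal. *)
Definition max_ideal A : set F := \bigcup_(M in maximal_ideals A) M.

Definition localize A P : set F :=
  [set x | exists a s, [/\ A a, A s, ~ P s & x = a / s]].

Definition gen_ideal A S : set F :=
  \bigcap_(I in [set I | is_ideal A I /\ S `<=` I]) I.

Definition coset D M (x : F) : set F := [set y | D y /\ M (y - x)].

Definition residue_field D M : set (set F) := [set coset D M x | x in D].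

Definition krull_dim_le A (n : nat) :=
  forall (m : nat) (P : nat -> set F),
    (forall i, (i <= m)%N -> prime_ideal A (P i)) ->
    (forall i, (i < m)%N -> P i `<` P i.+1) -> (m <= n)%N.

Definition finite_krull_dim A := exists n, krull_dim_le A n.

Definition integral_over A (x : F) :=
  exists p : {poly F}, [/\ p \is monic, p \is a polyOver (mem A) & root p x].

Definition integral_closure A : set F :=
  [set x | quotient_field A x /\ integral_over A x].

Definition valuation_ring V :=
  is_subring V /\ forall x, quotient_field V x -> V x \/ V x^-1.

Definition valuation_overring D V := overring D V /\ valuation_ring V.

Definition centered_on_maximal D V := maximal_ideal D (max_ideal V `&` D).

Definition no_common_proper_overring A V :=
  ~ exists B, [/\ is_subring B, A `<=` B, V `<=` B & B `<` quotient_field A].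

End SubsetsOfField.

Section Nagata.
Variable K : fieldType.
Implicit Types (A D : set K) (g : {poly K}).

Definition content A g : set K := gen_ideal A (range (fun i : nat => g`_i)).

Definition nagata A : set {fraction {poly K}} :=
  [set x | exists f g, [/\ f \is a polyOver (mem A), g \is a polyOver (mem A),
                           content A g = A & x = tofrac f / tofrac g]].

Definition kronecker D : set {fraction {poly K}} :=
  \bigcap_(V in [set V | valuation_overring D V /\ centered_on_maximal D V])
     nagata V.

End Nagata.

(* Main.v *)
(* Let E be the integral closure of A, and let R = Kr /\ A(t) where Kr is   *)
(* the Kronecker function ring of the integral closure of D. For a          *)
(* valuation ring V over D, finitely many elements of E have a D-linear     *)
(* combination d whose V-value is the least of theirs and which lies in a   *)
(* maximal ideal of E only if all of them do: each of the s + 1 tests (V    *)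
(* and the s maximal ideals) excludes at most one of the s + 2 points of a  *)
(* projective line over each residue field of D. Dividing a numerator and   *)
(* its primitive denominator by such a d gives A(t) /\ V(t) = (A /\ V)(t),  *)
(* and likewise for E. Together with Kronecker's trick this yields (i).     *)
(*   The valuation rings over Kr are the V(t), and an element of R that is  *)
(* a unit in Kr is a unit in R; hence every proper ideal of R lies in the   *)
(* center of some V(t), which gives (ii) and (iii).                         *)
(*   For (iv), let W be a valuation ring centered on a maximal ideal m of R *)
(* and V = W /\ K. Then W dominates R_m = B(t), where B is the localization *)
(* of A /\ V at the center of V, so t is transcendental over the residue    *)
(* field of B. Residues of elements of E /\ V are algebraic over it, so t   *)
(* stays transcendental over them, and W contains (E /\ V)(t) = E(t) /\     *)
(* V(t).                                                                    *)
Require Import Defs.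
From HB Require Import structures.
From mathcomp Require Import all_boot all_order all_algebra.
From mathcomp Require Import all_classical.
From mathcomp Require Import ring.
Set Implicit Arguments.
Unset Strict Implicit.
Unset Printing Implicit Defensive.
Import GRing.Theory.
Local Open Scope ring_scope.
Local Open Scope classical_set_scope.
Local Open Scope card_scope.

(** * Subrings of a field and Chevalley's theorem *)

(** Two tools carry the argument. The first is [chevalley]: a proper ideal of a subring consists of
    nonunits of some valuation ring above it. Hence integrality is membership in all valuation rings
    above ([integral_overP]), and every valuation ring contains one centered on a maximal ideal
    ([valring_dominating]). The second is a count: [avoiding_combination] finds one [D]-linear
    combination that passes all tests at once, and dividing by it gives [nagata_capV]. For (i),
    [localize_center] computes the localization and [no_common_overring_loc] identifies the ring
    obtained when [A] and [V] generate the whole field. For (ii) and (iii), [proper_ideal_center]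
    puts each proper ideal of the ring inside the center of some [V(t)]. In (iv), one inclusion is
    [integral_nagata]; the other is [integral_closure_sub_valring], which rests on the transcendence
    argument of [dominating_gauss]. *)

Section Subrings.
Variable F : fieldType.
Implicit Types (A B D V I J M P : set F) (x y a b : F) (f g p q : {poly F}).

Lemma is_subringP A : is_subring A <->
  [/\ A 1, forall x y, A x -> A y -> A (x - y)
    & forall x y, A x -> A y -> A (x * y)].
Proof.
split=> [[A1 AB AM]|[A1 AB AM]]; split.
- by move: A1; rewrite inE.
- by move=> x y Ax Ay; have := AB x y; rewrite !inE; apply.
- by move=> x y Ax Ay; have := AM x y; rewrite !inE; apply.
- by rewrite inE.
- by move=> x y; rewrite !inE; exact: AB.
- by move=> x y; rewrite !inE; exact: AM.
Qed.

(** [J] need not lie in [A], so fractional ideals and multiples [J * d] with [d] in the field are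
    included. Closure under negation follows when [A] is a subring. *)
Definition submodule A J :=
  [/\ J 0, (forall x y, J x -> J y -> J (x + y))
    & (forall a x, A a -> J x -> J (a * x))].

Definition coefs_in J f := forall i, J f`_i.

Section OneSubring.
Variable A : set F.
Hypothesis sA : is_subring A.

Lemma sub_1 : A 1. Proof. by case/is_subringP: sA. Qed.

Lemma sub_B x y : A x -> A y -> A (x - y).
Proof. by case/is_subringP: sA => _ + _; exact. Qed.

Lemma sub_M x y : A x -> A y -> A (x * y).
Proof. by case/is_subringP: sA => _ _; exact. Qed.

Lemma sub_0 : A 0.
Proof. by rewrite -(subrr 1); apply: sub_B sub_1 sub_1. Qed.

Lemma sub_N x : A x -> A (- x).
Proof. by move=> Ax; rewrite -sub0r; exact: sub_B sub_0 Ax. Qed.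

Lemma sub_D x y : A x -> A y -> A (x + y).
Proof. by move=> Ax Ay; rewrite -[y]opprK; apply: sub_B Ax (sub_N Ay). Qed.

Lemma sub_X x n : A x -> A (x ^+ n).
Proof.
move=> Ax; elim: n => [|n IHn]; first by rewrite expr0; exact: sub_1.
by rewrite exprS; exact: sub_M.
Qed.

Lemma submodule_self : submodule A A.
Proof. by split; [exact: sub_0|exact: sub_D|exact: sub_M]. Qed.

Lemma submodule_N J x : submodule A J -> J x -> J (- x).
Proof. by case=> _ _ JM Jx; rewrite -mulN1r; apply: JM => //; exact: sub_N sub_1. Qed.

Lemma submodule_B J x y : submodule A J -> J x -> J y -> J (x - y).
Proof. by move=> sJ Jx Jy; case: (sJ) => _ + _; apply => //; exact: submodule_N. Qed.

Lemma submodule_sum J : submodule A J ->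
  forall (T : Type) (r : seq T) (c : pred T) (E : T -> F),
  (forall i, c i -> J (E i)) -> J (\sum_(i <- r | c i) E i).
Proof. by case=> J0 JD _ *; exact: big_ind. Qed.

Lemma polyOver_coefs f : f \is a polyOver (mem A) <-> coefs_in A f.
Proof.
rewrite qualifE /=; split=> [/(all_nthP 0) Af i|Af]; last first.
  by apply/(all_nthP 0) => i _; rewrite inE; exact: Af.
have [/Af|/(nth_default 0)->] := ltnP i (size f); first by rewrite inE.
exact: sub_0.
Qed.

Lemma ideal_submodule I : is_ideal A I -> submodule A I.
Proof. by case. Qed.

Lemma ideal_submoduleI J : submodule A J -> is_ideal A (A `&` J).
Proof.
case=> J0 JD JM; split; first by move=> x [].
- by split => //; exact: sub_0.
- by move=> x y [Ax Jx] [Ay Jy]; split; [exact: sub_D|exact: JD].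
- by move=> a x Aa [Ax Jx]; split; [exact: sub_M|exact: JM].
Qed.

Lemma submodule_sub B J : B `<=` A -> submodule A J -> submodule B J.
Proof. by move=> BA [J0 JD JM]; split=> // a x /BA; exact: JM. Qed.

Lemma submodule_scale J d : submodule A J -> submodule A [set x | exists2 c, J c & x = c * d].
Proof.
case=> J0 JD JM; split; first by exists 0; rewrite ?mul0r.
- by move=> _ _ [c Jc ->] [c' Jc' ->]; exists (c + c'); [exact: JD|rewrite mulrDl].
- by move=> a _ Aa [c Jc ->]; exists (a * c); [exact: JM|rewrite mulrA].
Qed.

Lemma maximal_ideal_prime M : maximal_ideal A M -> prime_ideal A M.
Proof.
case=> iM M1 maxM; split=> // x y Ax Ay Mxy; have [MA M0 MD MM] := iM.
apply: contrapT => /not_orP[nMx nMy].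
pose J := [set z | exists m a, [/\ M m, A a & z = m + a * x]].
have MJ : M `<=` J.
  by move=> m Mm; exists m, 0; split=> //; [exact: sub_0|rewrite mul0r addr0].
have iJ : is_ideal A J.
  split.
  - by move=> _ [m [a [Mm Aa ->]]]; apply: sub_D; [exact: MA|exact: sub_M].
  - exact: MJ.
  - move=> _ _ [m [a [Mm Aa ->]]] [m' [a' [Mm' Aa' ->]]].
    exists (m + m'), (a + a'); split; [exact: MD|exact: sub_D|ring].
  - move=> c _ Ac [m [a [Mm Aa ->]]].
    exists (c * m), (c * a); split; [exact: MM|exact: sub_M|ring].
have Jx : J x by exists 0, 1; split=> //; [exact: sub_1|ring].
have [[m [a [Mm Aa E]]]|nJ1] := pselect (J 1); last first.
  by apply: nMx; rewrite -(maxM J iJ nJ1 MJ).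
apply: nMy; rewrite -[y]mul1r E.
have -> : (m + a * x) * y = y * m + a * (x * y) by ring.
by apply: MD; apply: MM.
Qed.

Lemma ideal_in_maximal I : is_ideal A I -> ~ I 1 ->
  exists2 M, maximal_ideal A M & I `<=` M.
Proof.
move=> iI nI1.
pose Q := [set X : set F | X = set0 \/ [/\ is_ideal A X, ~ X 1 & I `<=` X]].
have [|M [[M0|[iM nM1 IM]] maxM]] := @Zorn_bigcup F Q.
- move=> C CQ Ctot.
  have [[X0 CX0 [x0 X0x0]]|noX] := pselect (exists2 X, C X & X !=set0); last first.
    left; apply/eqP; apply: contra_notT noX => /set0P[x [X CX Xx]].
    by exists X => //; exists x.
  have nz X x : C X -> X x -> [/\ is_ideal A X, ~ X 1 & I `<=` X].
    by move=> CX Xx; case: (CQ X CX) => // XE; rewrite XE in Xx.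
  right; split.
  + split.
    * by move=> x [X CX Xx]; have [[XA _ _ _] _ _] := nz X x CX Xx; exact: XA.
    * by exists X0 => //; case: (nz X0 x0 CX0 X0x0) => -[].
    * move=> x y [X CX Xx] [Y CY Yy].
      have [XY|YX] := Ctot X Y CX CY.
        exists Y => //; have [[_ _ YD _] _ _] := nz Y y CY Yy.
        by apply: YD => //; exact: XY.
      exists X => //; have [[_ _ XD _] _ _] := nz X x CX Xx.
      by apply: XD => //; exact: YX.
    * move=> a x Aa [X CX Xx]; exists X => //.
      by have [[_ _ _ XM] _ _] := nz X x CX Xx; exact: XM.
  + by case=> X CX X1; case: (nz X 1 CX X1).
  + by move=> x Ix; exists X0 => //; case: (nz X0 x0 CX0 X0x0) => _ _; exact.
- have /maxM : M `<` I; last by case; right; split.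
  split; first by rewrite M0.
  by case: iI => _ I0 _ _ /(_ 0 I0); rewrite M0.
exists M => //; split=> // J iJ nJ1 MJ; apply: contrapT => nJM.
have /maxM : M `<` J; last by case; right; split=> //; exact: subset_trans MJ.
by split=> // JM; apply: nJM; rewrite eqEsubset.
Qed.

End OneSubring.

(** Serves for rings and ideals alike: for an ideal [J] of [A], [adjoin J x] is the extension of [J]
    to [A[x]]. *)
Definition adjoin A x : set F := [set z | exists2 p, coefs_in A p & z = p.[x]].

Lemma coefsD A J f g : submodule A J -> coefs_in J f -> coefs_in J g ->
  coefs_in J (f + g).
Proof. by case=> _ JD _ Jf Jg i; rewrite coefD; exact: JD. Qed.

Lemma coefsM A J f g : is_subring A -> submodule A J -> coefs_in A f ->
  coefs_in J g -> coefs_in J (f * g).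
Proof.
move=> sA sJ Af Jg i; rewrite coefM; apply: (submodule_sum sJ) => j _.
by case: sJ => _ _; apply.
Qed.

Lemma coefsC A J a : submodule A J -> J a -> coefs_in J a%:P.
Proof. by case=> J0 _ _ Ja i; rewrite coefC; case: eqP. Qed.

Lemma coefsXn A n : is_subring A -> coefs_in A 'X^n.
Proof.
by move=> sA i; rewrite coefXn; case: eqP => _; [exact: sub_1|exact: sub_0].
Qed.

Lemma adjoin_subring A x : is_subring A -> is_subring (adjoin A x).
Proof.
move=> sA; have sAA := submodule_self sA; apply/is_subringP; split.
- by exists 1%:P; [apply: coefsC sAA _; exact: sub_1|rewrite hornerC].
- move=> _ _ [p Ap ->] [q Aq ->]; exists (p - q); last by rewrite hornerD hornerN.
  apply: (coefsD sAA) => // i; rewrite coefN; exact: sub_N.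
- move=> _ _ [p Ap ->] [q Aq ->]; exists (p * q); last by rewrite hornerM.
  exact: (coefsM sA sAA).
Qed.

Lemma adjoin_id A x : is_subring A -> adjoin A x x.
Proof.
by move=> sA; exists 'X; [rewrite -['X]expr1; exact: coefsXn|rewrite hornerX].
Qed.

Lemma sub_adjoin A J x : submodule A J -> J `<=` adjoin J x.
Proof. by move=> sJ a Ja; exists a%:P; [exact: coefsC sJ Ja|rewrite hornerC]. Qed.

Lemma adjoin_ideal A J x : is_subring A -> is_ideal A J ->
  is_ideal (adjoin A x) (adjoin J x).
Proof.
move=> sA iJ; have sJ := ideal_submodule iJ; split.
- by case: iJ => JA _ _ _ _ [p Jp ->]; exists p => // i; exact: JA.
- by exists 0; [move=> i; rewrite coef0; case: sJ|rewrite horner0].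
- move=> _ _ [p Jp ->] [q Jq ->]; exists (p + q); last by rewrite hornerD.
  exact: coefsD sJ Jp Jq.
- move=> _ _ [p Ap ->] [q Jq ->]; exists (p * q); last by rewrite hornerM.
  exact: (coefsM sA sJ).
Qed.

(* Descent of Chevalley's theorem: from two relations [1 = p(x) = q(1/x)] with *)
(* coefficients in [J], the shorter one lowers the degree of the other.        *)
Lemma adjoin_descent B J x n p q : is_subring B -> is_ideal B J -> ~ J 1 ->
  (size p + size q <= n)%N -> coefs_in J p -> coefs_in J q ->
  p.[x] = 1 -> q.[x^-1] = 1 -> False.
Proof.
move=> sB iJ nJ1; have sJ := ideal_submodule iJ; have JB : J `<=` B by case: iJ.
elim: n x p q => [|n IHn] x p q le_n Jp Jq px qx.
  move: le_n; rewrite leqn0 addn_eq0 size_poly_eq0 => /andP[/eqP p0 _].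
  by move: px; rewrite p0 horner0 => /eqP; rewrite eq_sym oner_eq0.
(* The situation is symmetric under exchanging [x] with [x^-1] and [p] with [q]. *)
wlog le_qp : x p q le_n Jp Jq px qx / (size q <= size p)%N.
  move=> W; have [|/ltnW le_pq] := leqP (size q) (size p); first exact: (W x p q).
  by apply: (W x^-1 q p); rewrite ?invrK // addnC.
have [m size_p] : exists m, size p = m.+1.
  case E: (size p) => [|m]; last by exists m.
  move: E px => /eqP; rewrite size_poly_eq0 => /eqP->.
  by rewrite horner0 => /eqP; rewrite eq_sym oner_eq0.
case: m => [|m] in size_p *.
  apply: nJ1; rewrite -px [p]size1_polyC ?size_p // hornerC; exact: Jp.
have x0 : x != 0.
  apply: contra_notN nJ1 => /eqP x0; rewrite -px x0 horner_coef0; exact: Jp.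
(* Multiply [p(x) = 1] by [1 - q_0], then use [q(1/x) = 1], multiplied by [x^(m+1)], to replace
   [(1 - q_0) x^(m+1)] by terms of degree at most [m]. Adding [q_0] restores the value 1. *)
pose p' := \poly_(k < m.+1) ((1 - q`_0) * p`_k + p`_m.+1 * q`_(m.+1 - k)
                             + (k == 0)%:R * q`_0).
have J0 : J 0 by case: sJ.
have J1q : B (1 - q`_0) by apply: sub_B => //; [exact: sub_1|exact/JB/Jq].
apply: (IHn x p' q) => //.
- rewrite -ltnS; apply: leq_trans le_n; rewrite size_p addSn ltnS leq_add2r.
  exact: size_poly.
- move=> k; rewrite coef_poly; case: ifP => // _.
  case: sJ => _ JD JM; apply: (JD); first apply: (JD); apply: (JM) => //.
  + exact/JB/Jp.
  + by case: eqP => _; [exact: sub_1|exact: sub_0].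
rewrite horner_poly.
have Ep : \sum_(i < m.+1) p`_i * x ^+ i = 1 - p`_m.+1 * x ^+ m.+1.
  by rewrite -px (@horner_coef_wide _ m.+2) ?size_p // [in RHS]big_ord_recr /= addrK.
have Eq : \sum_(i < m.+1) q`_(m.+1 - i) * x ^+ i = x ^+ m.+1 * (1 - q`_0).
  have -> : 1 - q`_0 = \sum_(i < m.+1) q`_i.+1 * x^-1 ^+ i.+1.
    rewrite -qx (@horner_coef_wide _ m.+2) -?size_p // size_p.
    by rewrite big_ord_recl expr0 mulr1 addrC addKr.
  rewrite mulr_sumr (reindex_inj rev_ord_inj) /=.
  apply: eq_bigr => i _; have le_im : (i <= m)%N by rewrite -ltnS.
  rewrite subSS subSn ?leq_subr // subKn // mulrCA; congr (_ * _).
  have {2}-> : m.+1 = (m - i + i.+1)%N by rewrite addnS subnK.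
  by rewrite exprD exprVn mulfK // expf_neq0.
transitivity ((1 - q`_0) * \sum_(i < m.+1) p`_i * x ^+ i
  + p`_m.+1 * (\sum_(i < m.+1) q`_(m.+1 - i) * x ^+ i) + q`_0).
  have E0 : \sum_(i < m.+1) (i == 0 :> nat)%:R * q`_0 * x ^+ i = q`_0.
    rewrite big_ord_recl /= expr0 mulr1 mul1r big1 ?addr0 // => i _.
    by rewrite !mul0r.
  rewrite -[X in _ = _ + X]E0 !mulr_sumr -!big_split /=; apply: eq_bigr => i _; ring.
by rewrite Ep Eq; ring.
Qed.

(** The dichotomy is required for all of [F], not just for the quotient field of [V] as in
    [valuation_ring]; [valuation_overringE] reconciles the two. *)
Definition valring V := is_subring V /\ forall x, V x \/ V x^-1.

(* [x = 0] is listed apart because [0^-1 = 0] lies in [V]. *)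
Definition nonunits V : set F := [set x | x = 0 \/ ~ V x^-1].

(** Take a maximal pair of a ring [B] and a proper ideal [J] above [A] and [I]. If neither [x] nor
    [x^-1] were in [B], maximality would put 1 in the extensions of [J] to both [B[x]] and
    [B[x^-1]], contrary to [adjoin_descent]. *)
Theorem chevalley A I : is_subring A -> is_ideal A I -> ~ I 1 ->
  exists V, [/\ valring V, A `<=` V & I `<=` nonunits V].
Proof.
move=> sA iI nI1.
(* A pair of a ring and an ideal is coded as one subset of [F * bool], so that Zorn's lemma for
   inclusion orders both components at once. *)
pose rg (X : set (F * bool)) := [set x | X (x, true)].
pose id (X : set (F * bool)) := [set x | X (x, false)].
pose good X := [/\ is_subring (rg X), is_ideal (rg X) (id X), ~ id X 1,
                   A `<=` rg X & I `<=` id X].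
pose pair B J : set (F * bool) := [set z | if z.2 then B z.1 else J z.1].
have rgP B J : rg (pair B J) = B by apply/seteqP; split.
have idP B J : id (pair B J) = J by apply/seteqP; split.
have [|X [[X0|[sB iJ nJ1 AB IJ]] maxX]] :=
    @Zorn_bigcup _ [set X | X = set0 \/ good X].
- move=> C CQ Ctot.
  have [[X0 CX0 [x0 X0x0]]|noX] := pselect (exists2 X, C X & X !=set0); last first.
    left; apply/eqP; apply: contra_notT noX => /set0P[x [X CX Xx]].
    by exists X => //; exists x.
  have nz X (x : F * bool) : C X -> X x -> good X.
    by move=> CX Xx; case: (CQ X CX) => // XE; rewrite XE in Xx.
  have two x y (b c : bool) : (\bigcup_(X in C) X) (x, b) -> (\bigcup_(X in C) X) (y, c) ->
      exists X, [/\ C X, good X, X (x, b) & X (y, c)].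
    move=> [X CX Xx] [Y CY Yy]; have [XY|YX] := Ctot X Y CX CY.
      by exists Y; split=> //; [exact: nz Yy|exact: XY].
    by exists X; split=> //; [exact: nz Xx|exact: YX].
  right; have [sX0 iX0 _ AX0 IX0] := nz X0 x0 CX0 X0x0; split.
  + apply/is_subringP; split; first by exists X0 => //; exact: (sub_1 sX0).
    * move=> x y Ux Uy; have [X [CX [sX _ _ _ _] Xx Xy]] := two _ _ _ _ Ux Uy.
      by exists X => //; exact: (sub_B sX Xx Xy).
    * move=> x y Ux Uy; have [X [CX [sX _ _ _ _] Xx Xy]] := two _ _ _ _ Ux Uy.
      by exists X => //; exact: (sub_M sX Xx Xy).
  + split.
    * move=> x [X CX Xx]; exists X => //.
      by have [_ [+ _ _ _] _ _ _] := nz _ _ CX Xx; apply.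
    * by exists X0 => //; case: iX0.
    * move=> x y Ux Uy; have [X [CX [_ iX _ _ _] Xx Xy]] := two _ _ _ _ Ux Uy.
      by exists X => //; case: iX => _ _ + _; apply.
    * move=> x y Ux Uy; have [X [CX [_ iX _ _ _] Xx Xy]] := two _ _ _ _ Ux Uy.
      by exists X => //; case: iX => _ _ _; apply.
  + by move=> [X CX X1]; have [_ _ + _ _] := nz _ _ CX X1; apply.
  + by move=> x /AX0 X0x; exists X0.
  + by move=> x /IX0 X0x; exists X0.
- have /maxX : X `<` pair A I.
    rewrite X0; split=> [[x b]//|].
    by case: iI => _ I0 _ _ /(_ (0, false) I0).
  by case; right; split; rewrite ?rgP ?idP.
have sJ := ideal_submodule iJ.
have step x : ~ adjoin (id X) x 1 -> rg X x.
  move=> nJx1.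
  have good' : good (pair (adjoin (rg X) x) (adjoin (id X) x)).
    split; rewrite ?rgP ?idP //; first exact: adjoin_subring.
    - exact: adjoin_ideal.
    - exact: subset_trans AB (sub_adjoin x (submodule_self sB)).
    - exact: subset_trans IJ (sub_adjoin x sJ).
  have XX : X `<=` pair (adjoin (rg X) x) (adjoin (id X) x).
    move=> [y []] Xy /=; first exact: (sub_adjoin x (submodule_self sB) Xy).
    exact: (sub_adjoin x sJ Xy).
  apply: contrapT => nXx.
  have /maxX : X `<` pair (adjoin (rg X) x) (adjoin (id X) x); last by case; right.
  by split=> // /(_ (x, true)) /(_ (adjoin_id x sB)).
exists (rg X); split=> //.
- split=> // x; apply: contrapT => /not_orP[nx nx'].
  have [[p Jp px] [q Jq qx]] : adjoin (id X) x 1 /\ adjoin (id X) x^-1 1.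
    by split; apply: contrapT => /step.
  exact: (adjoin_descent sB iJ nJ1 (leqnn _) Jp Jq (esym px) (esym qx)).
- move=> x /IJ Jx; have [->|x0] := eqVneq x 0; first by left.
  by right=> Bx'; apply: nJ1; rewrite -(mulVf x0); case: iJ => _ _ _; exact.
Qed.

End Subrings.

(** * Valuation rings *)

Section Valrings.
Variable F : fieldType.
Implicit Types (A B D V W I J M P : set F) (x y a b : F) (f g p q : {poly F}).

Lemma nonunitsN V x : ~ nonunits V x <-> x != 0 /\ V x^-1.
Proof.
split=> [/not_orP[/eqP x0 /contrapT]//|[x0 Vx]].
by case=> [xE|//]; rewrite xE eqxx in x0.
Qed.

Lemma nonunits_inv V x : ~ V x -> nonunits V x^-1.
Proof. by right; rewrite invrK. Qed.

Section OneValring.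
Variable V : set F.
Hypothesis vV : valring V.

Let sV : is_subring V. Proof. by case: vV. Qed.

Lemma nonunits1 : ~ nonunits V 1.
Proof. by apply/nonunitsN; rewrite oner_neq0 invr1; split => //; exact: sub_1. Qed.

Lemma nonunits_sub : nonunits V `<=` V.
Proof.
move=> x [->|nVx]; first exact: sub_0.
by case: vV => _ /(_ x) [].
Qed.

Lemma nonunits_submodule : submodule V (nonunits V).
Proof.
have JM a x : V a -> nonunits V x -> nonunits V (a * x).
  move=> Va; apply: contraPP => /nonunitsN[ax0 Vax].
  move: (ax0); rewrite mulf_eq0 => /norP[a0 x0]; apply/nonunitsN; split=> //.
  have -> : x^-1 = a * (a * x)^-1 by field; rewrite x0.
  exact: sub_M.
split=> //; first by left.
move=> x y Nx Ny.
wlog Vxy : x y Nx Ny / V (x / y).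
  move=> W; case: (vV) => _ /(_ (x / y)) [|]; first exact: W.
  by rewrite invf_div addrC; exact: W.
have [y0|y0] := eqVneq y 0; first by rewrite y0 addr0.
have -> : x + y = (x / y + 1) * y by field.
by apply: JM => //; apply: sub_D => //; exact: sub_1.
Qed.

Lemma nonunits_ideal : is_ideal V (nonunits V).
Proof. by case: nonunits_submodule => *; split=> //; exact: nonunits_sub. Qed.

Lemma nonunits_maximal : maximal_ideal V (nonunits V).
Proof.
split; [exact: nonunits_ideal|exact: nonunits1|move=> J iJ nJ1 NJ].
apply/seteqP; split=> // x Jx; apply: contrapT => /nonunitsN[x0 Vx].
by apply: nJ1; rewrite -(mulVf x0); case: iJ => _ _ _; apply.
Qed.

Lemma max_idealE : max_ideal V = nonunits V.
Proof.
apply/seteqP; split=> [x [M [iM nM1 maxM] Mx]|x Nx]; last first.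
  by exists (nonunits V) => //; exact: nonunits_maximal.
apply: contrapT => /nonunitsN[x0 Vx].
by apply: nM1; rewrite -(mulVf x0); case: iM => _ _ _; apply.
Qed.

Lemma nonunits_prime x y : V x -> V y -> nonunits V (x * y) ->
  nonunits V x \/ nonunits V y.
Proof.
have [] := maximal_ideal_prime sV nonunits_maximal.
by move=> _ _; exact.
Qed.

(** If [x] is not in [V], then [x^-1] is, and dividing the equation by a power of [x] expresses the
    product through lower coefficients and powers of [x^-1]. The polynomial need not be monic, which
    matters in [valring_top_coef] and [integral_nagata]. *)
Lemma lead_coef_mul_root p x : coefs_in V p -> root p x -> V (lead_coef p * x).
Proof.
move=> Vp /rootP px.
have [Vx|nVx] := pselect (V x); first by apply: sub_M => //; exact: Vp.
have Vx' : V x^-1 by case: vV => _ /(_ x) [].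
have x0 : x != 0 by apply: contra_notN nVx => /eqP->; exact: sub_0.
rewrite lead_coefE; case E : (size p) => [|[|k]] /=.
- by move/eqP: E; rewrite size_poly_eq0 => /eqP->; rewrite coef0 mul0r; exact: sub_0.
- move: px; rewrite [p]size1_polyC ?E // hornerC coefC /= => ->.
  by rewrite mul0r; exact: sub_0.
have -> : p`_k.+1 * x = - \sum_(i < k.+1) p`_i * x^-1 ^+ (k - i).
  apply: (mulIf (expf_neq0 k x0)); rewrite mulNr -mulrA -exprS mulr_suml.
  move: px; rewrite horner_coef E big_ord_recr /= addrC => /eqP.
  rewrite addr_eq0 => /eqP->; congr (- _); apply: eq_bigr => i _.
  have le_ik : (i <= k)%N by rewrite -ltnS.
  by rewrite -mulrA exprVn -[in x ^+ k](subnKC le_ik) addnC exprD mulKf ?expf_neq0.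
apply: sub_N => //; apply: (submodule_sum (submodule_self sV)) => i _.
by apply: sub_M => //; apply: sub_X.
Qed.

Lemma valring_integral x : integral_over V x -> V x.
Proof.
case=> p [/monicP lp /(polyOver_coefs sV) Vp px].
by rewrite -[x]mul1r -lp; exact: lead_coef_mul_root.
Qed.

End OneValring.

Lemma integral_over_sub A B x : A `<=` B -> integral_over A x -> integral_over B x.
Proof.
move=> AB [p [mp Ap px]]; exists p; split=> //.
rewrite qualifE /= in Ap *; apply: sub_all Ap => y; rewrite !inE; exact: AB.
Qed.

Lemma sub_integral_over A x : is_subring A -> A x -> integral_over A x.
Proof.
move=> sA Ax; exists ('X - x%:P); split; [exact: monicXsubC| |by rewrite root_XsubC].
apply/(polyOver_coefs sA); apply: (coefsD (submodule_self sA)).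
  by rewrite -['X]expr1; exact: coefsXn.
by move=> i; rewrite coefN; apply: (sub_N sA); exact: (coefsC (submodule_self sA)).
Qed.

(** If [x] is not integral, [x^-1] generates a proper ideal of [A[x^-1]]. A valuation ring in which
    [x^-1] is a nonunit contains [A] but not [x]. *)
Lemma integral_overP A x : is_subring A ->
  integral_over A x <-> forall V, valring V -> A `<=` V -> V x.
Proof.
move=> sA; split=> [Ax V vV AV|Vx].
  by apply: valring_integral => //; exact: integral_over_sub Ax.
apply: contrapT => nAx.
have x0 : x != 0.
  by apply: contra_notN nAx => /eqP->; apply: sub_integral_over => //; exact: sub_0.
pose B := adjoin A x^-1; have sB : is_subring B by exact: adjoin_subring.
pose I := [set z | exists2 c, B c & z = c * x^-1].
have sI : submodule B I by exact: submodule_scale (submodule_self sB).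
have Bx : B x^-1 by exact: adjoin_id.
have iI : is_ideal B I by case: sI => *; split=> // _ [c Bc ->]; exact: sub_M.
have nI1 : ~ I 1.
  case=> _ [p Ap ->] E; apply: nAx.
  (* The relation [1 = p(1/x) / x] times [x^(n+1)] is a monic equation for [x]. Taking [n = size p]
     only adds a zero coefficient. *)
  pose n := size p; pose q : {poly F} := 'X^(n.+1) - \poly_(k < n.+1) p`_(n - k).
  have sq : (size (- \poly_(k < n.+1) p`_(n - k) : {poly F})%R <= n.+1)%N.
    by rewrite size_polyN size_poly.
  exists q; split.
  - by rewrite monicE lead_coefDl ?lead_coefXn // size_polyXn ltnS.
  - apply/(polyOver_coefs sA) => i; rewrite coefD coefN; apply: (sub_B sA).
      exact: coefsXn.
    by rewrite coef_poly; case: ifP => _ //; exact: sub_0.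
  - apply/rootP; rewrite hornerD hornerN hornerXn horner_poly.
    apply/eqP; rewrite subr_eq0; apply/eqP.
    transitivity (x ^+ n * p.[x^-1]).
      have -> : p.[x^-1] = x by rewrite -[RHS]mul1r E mulfVK.
      by rewrite exprSr.
    rewrite (@horner_coef_wide _ n.+1) ?leqnSn // mulr_sumr (reindex_inj rev_ord_inj) /=.
    apply: eq_bigr => i _; have le_in : (i <= n)%N by rewrite -ltnS.
    rewrite subSS mulrCA; congr (_ * _).
    have {1}-> : n = (i + (n - i))%N by rewrite subnKC.
    by rewrite exprD exprVn mulfK // expf_neq0.
have [V [vV BV IV]] := chevalley sB iI nI1.
have /IV[/eqP|] : I x^-1 by exists 1; rewrite ?mul1r //; exact: sub_1.
  by rewrite invr_eq0 (negPf x0).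
rewrite invrK; apply; apply: Vx => //.
exact: (subset_trans (sub_adjoin x^-1 (submodule_self sA)) BV).
Qed.

Lemma valring_integral_closure A V : is_subring A -> valring V -> A `<=` V ->
  integral_closure A `<=` V.
Proof. by move=> sA vV AV x [_ /(integral_overP x sA)]; apply. Qed.

(** Choose a maximal ideal [M] of [A] above the center of [V] and apply Chevalley's theorem to
    [M + m_V] inside [A + m_V]. The new ring lies in [V] because its nonunits include [m_V]. *)
Lemma valring_dominating A V : is_subring A -> valring V -> A `<=` V ->
  exists W, [/\ valring W, A `<=` W, W `<=` V, nonunits V `<=` nonunits W
              & maximal_ideal A (nonunits W `&` A)].
Proof.
move=> sA vV AV; have [sV _] := vV; have sN := nonunits_submodule vV.
have [M maxM PM] : exists2 M, maximal_ideal A M & A `&` nonunits V `<=` M.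
  apply: ideal_in_maximal => //.
    by apply: ideal_submoduleI => //; exact: submodule_sub sN.
  by case=> _; exact: nonunits1.
have [iM nM1 maxMJ] := maxM; have [MA M0 MD MM] := iM.
pose ext S : set F := [set z | exists a m, [/\ S a, nonunits V m & z = a + m]].
have AextA : A `<=` ext A by move=> a Aa; exists a, 0; split=> //; [left|rewrite addr0].
have sE : is_subring (ext A).
  apply/is_subringP; split; first by apply: AextA; exact: sub_1.
  - move=> _ _ [a [m [Aa Nm ->]]] [a' [m' [Aa' Nm' ->]]].
    exists (a - a'), (m - m'); split; [exact: sub_B| |ring].
    exact: (submodule_B sV sN).
  - move=> _ _ [a [m [Aa Nm ->]]] [a' [m' [Aa' Nm' ->]]].
    exists (a * a'), (a * m' + (a' + m') * m); split; [exact: sub_M| |ring].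
    case: (sN) => _ ND NM; apply: (ND); apply: (NM) => //; first exact: AV.
    by apply: sub_D => //; [exact: AV|exact: nonunits_sub].
have iE : is_ideal (ext A) (ext M).
  split.
  - by move=> _ [a [m [Ma Nm ->]]]; exists a, m; split=> //; exact: MA.
  - by exists 0, 0; split=> //; [left|rewrite addr0].
  - move=> _ _ [a [m [Ma Nm ->]]] [a' [m' [Ma' Nm' ->]]].
    exists (a + a'), (m + m'); split; [exact: MD| |ring].
    by case: (sN) => _ + _; apply.
  - move=> _ _ [a [m [Aa Nm ->]]] [a' [m' [Ma' Nm' ->]]].
    exists (a * a'), (a * m' + (a' + m') * m); split; [exact: MM| |ring].
    case: (sN) => _ ND NM; apply: (ND); apply: (NM) => //; first exact: AV.
    by apply: sub_D => //; [exact/AV/MA|exact: nonunits_sub].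
have nE1 : ~ ext M 1.
  (* If [1 = a + m], then [m = 1 - a] lies in both [A] and [m_V], hence in [M], and so would 1. *)
  case=> a [m [Ma Nm E]]; apply: nM1; rewrite E; apply: (MD) => //; apply: PM.
  split=> //; have -> : m = 1 - a by rewrite E addrC addKr.
  by apply: sub_B => //; [exact: sub_1|exact: MA].
have [W [vW EW MW]] := chevalley sE iE nE1.
have NW : nonunits V `<=` nonunits W.
  by move=> m Nm; apply: MW; exists 0, m; rewrite add0r.
have MNW : M `<=` nonunits W `&` A.
  move=> m Mm; split; last exact: MA.
  by apply: MW; exists m, 0; rewrite addr0; split=> //; left.
have AW : A `<=` W by exact: subset_trans EW.
exists W; split=> //.
  move=> x Wx; apply: contrapT => nVx.
  case: (NW _ (nonunits_inv nVx)) => [/eqP|]; last by rewrite invrK.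
  by rewrite invr_eq0 => /eqP x0; apply: nVx; rewrite x0; exact: sub_0.
rewrite (maxMJ _ _ _ MNW) //; last by case=> /(nonunits1 vW).
by rewrite setIC; apply: ideal_submoduleI => //; exact: submodule_sub (nonunits_submodule vW).
Qed.

End Valrings.

(** * Nagata rings and Gauss extensions *)

Lemma fracP (R : idomainType) (x : {fraction R}) :
  exists f g : R, g != 0 /\ x = tofrac f / tofrac g.
Proof.
elim/quotW: x => y; exists \n_y, \d_y; split; first exact: denom_ratioP.
apply: (mulIf (x := tofrac \d_y)); first by rewrite tofrac_eq0 denom_ratioP.
rewrite mulfVK ?tofrac_eq0 ?denom_ratioP // !piE; apply/eqmodP.
rewrite /= FracField.equivfE /FracField.mulf !numden_Ratio ?mulr1 ?oner_neq0 ?denom_ratioP //.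
by rewrite mulrC.
Qed.

Section Nagata.
Variable K : fieldType.
Implicit Types (A B D V W I J M P : set K) (x y a b d : K) (f g h p q : {poly K}).

(* Submodules of the whole field, rather than ideals of [A], let contents be *)
(* compared after rescaling by arbitrary elements of [K].                    *)
Definition content_le A f g :=
  forall J, submodule A J -> coefs_in J g -> coefs_in J f.

Definition primitive A g := forall J, submodule A J -> coefs_in J g -> J 1.

Lemma content_primitive A g : is_subring A -> coefs_in A g ->
  content A g = A <-> primitive A g.
Proof.
move=> sA Ag; split=> [cg J sJ Jg|pg].
  have : A 1 by exact: sub_1.
  rewrite -cg => /(_ (A `&` J)) []//; split; first exact: ideal_submoduleI.
  by move=> _ [i _ <-]; split; [exact: Ag|exact: Jg].
have iA : is_ideal A A by case: (submodule_self sA) => *; split.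
apply/seteqP; split=> [x /(_ A)|x Ax I [iI gI]].
  by apply; split=> // _ [i _ <-]; exact: Ag.
case: (iI) => _ _ _ IM; rewrite -[x]mulr1; apply: IM => //.
by apply: pg (ideal_submodule iI) _ => i; apply: gI; exists i.
Qed.

Lemma nagataP A (x : {fraction {poly K}}) : is_subring A ->
  nagata A x <-> exists f g, [/\ coefs_in A f, coefs_in A g, primitive A g
                               & x = tofrac f / tofrac g].
Proof.
move=> sA; split=> [[f [g [/(polyOver_coefs sA) Af /(polyOver_coefs sA) Ag]]]|].
  by move=> /(content_primitive sA Ag) pg xE; exists f, g.
move=> [f [g [Af Ag pg xE]]]; exists f, g.
by split=> //; [exact/polyOver_coefs|exact/polyOver_coefs|exact/content_primitive].
Qed.

Lemma submodule_set0 A : submodule A [set 0].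
Proof.
split=> //; first by move=> x y -> ->; rewrite addr0.
by move=> a x _ ->; rewrite mulr0.
Qed.

Lemma primitive_neq0 A g : primitive A g -> g != 0.
Proof.
move=> pg; apply/eqP => g0; suff /eqP : [set 0] (1 : K) by rewrite oner_eq0.
by apply: pg (@submodule_set0 A) _ => i; rewrite g0 coef0.
Qed.

Lemma coefs_in_sub A B f : A `<=` B -> coefs_in A f -> coefs_in B f.
Proof. by move=> AB Af i; exact: AB. Qed.

Lemma primitive_sub A B g : A `<=` B -> primitive A g -> primitive B g.
Proof. by move=> AB pg J sJ; apply: pg; exact: submodule_sub sJ. Qed.

Lemma primitive_maximal A g : is_subring A ->
  (forall M, maximal_ideal A M -> ~ coefs_in M g) -> coefs_in A g -> primitive A g.
Proof.
move=> sA nM Ag J sJ Jg; apply: contrapT => nJ1.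
have [|M maxM JM] := ideal_in_maximal (ideal_submoduleI sA sJ); first by case.
by apply: (nM M maxM) => i; apply: JM.
Qed.

Lemma primitive_prime A P g : is_ideal A P -> ~ P 1 -> primitive A g -> ~ coefs_in P g.
Proof. by move=> iP nP1 pg Pg; apply: nP1; apply: pg Pg; exact: ideal_submodule. Qed.

(** Gauss's lemma: if [f_i] and [g_j] are the first coefficients outside [P], the coefficient of
    [f * g] in degree [i + j] is [f_i * g_j] modulo [P]. *)
Lemma prime_coefsM A P f g : is_subring A -> prime_ideal A P ->
  coefs_in A f -> coefs_in A g ->
  coefs_in P (f * g) -> coefs_in P f \/ coefs_in P g.
Proof.
move=> sA [iP _ PM] Af Ag Pfg; apply: contrapT => /not_orP[].
move=> /existsNP[i0 Pi0] /existsNP[j0 Pj0].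
have [i /asboolP nPi min_i] := ex_minnP (ex_intro (fun i => `[< ~ P f`_i >]) i0 (asboolT Pi0)).
have [j /asboolP nPj min_j] := ex_minnP (ex_intro (fun i => `[< ~ P g`_i >]) j0 (asboolT Pj0)).
have lt_i k : (k < i)%N -> P f`_k.
  by move=> lt_ki; apply: contrapT => /asboolP/min_i; rewrite leqNgt lt_ki.
have lt_j k : (k < j)%N -> P g`_k.
  by move=> lt_kj; apply: contrapT => /asboolP/min_j; rewrite leqNgt lt_kj.
have sP := ideal_submodule iP; have [_ _ PS] := sP.
have lt_iij : (i < (i + j).+1)%N by rewrite ltnS leq_addr.
have := Pfg (i + j)%N; rewrite coefM (bigD1 (Ordinal lt_iij)) //= addKn => Ps.
suff /PM[] : P (f`_i * g`_j) by [].
pose s := \sum_(k < (i + j).+1 | k != Ordinal lt_iij) f`_k * g`_(i + j - k).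
rewrite -[_ * _](addrK s); apply: (submodule_B sA sP) => //.
apply: (submodule_sum sP) => k nk; have [lt_ki|lt_ik|eq_ki] := ltngtP k i.
- by rewrite mulrC; apply: PS => //; exact: lt_i.
- apply: PS => //; apply: lt_j.
  by rewrite ltn_subLR ?ltn_add2r // -ltnS.
- by case/eqP: nk; exact: val_inj.
Qed.

Lemma primitiveM A f g : is_subring A -> coefs_in A f -> coefs_in A g ->
  primitive A f -> primitive A g -> primitive A (f * g).
Proof.
move=> sA Af Ag pf pg; apply: (primitive_maximal sA); last first.
  exact: coefsM sA (submodule_self sA) Af Ag.
move=> M maxM; have [iM nM1 _] := maxM.
move=> /(prime_coefsM sA (maximal_ideal_prime sA maxM) Af Ag) [].
  exact: primitive_prime pf.
exact: primitive_prime pg.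
Qed.

Lemma primitive1 A : primitive A 1.
Proof. by move=> J _ /(_ 0%N); rewrite coef1. Qed.

Lemma coefs1 A : is_subring A -> coefs_in A 1.
Proof. by move=> sA; apply: (coefsC (submodule_self sA)); exact: sub_1. Qed.

Lemma nagata_poly A f : is_subring A -> coefs_in A f -> nagata A (tofrac f).
Proof.
move=> sA Af; apply/(nagataP _ sA); exists f, 1; rewrite tofrac1 divr1.
by split=> //; [exact: coefs1|exact: primitive1].
Qed.

Lemma nagata_subring A : is_subring A -> is_subring (nagata A).
Proof.
move=> sA; have sAA := submodule_self sA; apply/is_subringP; split.
- by rewrite -tofrac1; apply: nagata_poly => //; exact: coefs1.
- move=> x y /(nagataP _ sA)[f [g [Af Ag pg ->]]] /(nagataP _ sA)[f' [g' [Af' Ag' pg' ->]]].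
  apply/(nagataP _ sA); exists (f * g' - f' * g), (g * g'); split.
  + apply: (coefsD sAA); first exact: (coefsM sA sAA).
    by move=> i; rewrite coefN; apply: sub_N => //; exact: (coefsM sA sAA).
  + exact: (coefsM sA sAA).
  + exact: primitiveM.
  + rewrite tofracB !tofracM -[in LHS]mulNr addf_div ?mulNr //.
      by rewrite tofrac_eq0 (primitive_neq0 pg).
    by rewrite tofrac_eq0 (primitive_neq0 pg').
- move=> x y /(nagataP _ sA)[f [g [Af Ag pg ->]]] /(nagataP _ sA)[f' [g' [Af' Ag' pg' ->]]].
  apply/(nagataP _ sA); exists (f * f'), (g * g').
  split; [exact: (coefsM sA sAA)|exact: (coefsM sA sAA)|exact: primitiveM|].
  by rewrite !tofracM mulf_div.
Qed.

Lemma nagata_sub A B : is_subring A -> is_subring B -> A `<=` B ->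
  nagata A `<=` nagata B.
Proof.
move=> sA sB AB x /(nagataP _ sA)[f [g [Af Ag pg ->]]]; apply/(nagataP _ sB).
exists f, g; split=> //; [exact: coefs_in_sub Af|exact: coefs_in_sub Ag|].
exact: primitive_sub pg.
Qed.

(** The shift by [size f] juxtaposes the two coefficient lists without cancellation, so the content
    of [catp f g] is the sum of both contents over every ring. *)
Definition catp f g := f + 'X^(size f) * g.

Lemma coef_catp f g i :
  (catp f g)`_i = if (i < size f)%N then f`_i else g`_(i - size f).
Proof.
rewrite coefD coefXnM; case: ltnP => le_fi; first by rewrite addr0.
by rewrite nth_default // add0r.
Qed.

Lemma coefs_catp J f g : J 0 ->
  coefs_in J (catp f g) <-> coefs_in J f /\ coefs_in J g.
Proof.
move=> J0; split=> [Jfg|[Jf Jg] i]; last by rewrite coef_catp; case: ifP.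
split=> i; last by have := Jfg (size f + i)%N; rewrite coef_catp ltnNge leq_addr addKn.
have [lt_i|/(nth_default 0)->//] := ltnP i (size f).
by have := Jfg i; rewrite coef_catp lt_i.
Qed.

Lemma content_le_catl A f g : content_le A f (catp f g).
Proof. by move=> J [J0 _ _] /(coefs_catp _ _ J0)[]. Qed.

Lemma content_le_catr A f g : content_le A g (catp f g).
Proof. by move=> J [J0 _ _] /(coefs_catp _ _ J0)[]. Qed.

Lemma content_le_trans A f g h : content_le A f g -> content_le A g h -> content_le A f h.
Proof. by move=> fg gh J sJ /(gh J sJ); exact: fg. Qed.

Lemma primitive_content_le A f g : content_le A f g -> primitive A f -> primitive A g.
Proof. by move=> fg pf J sJ /(fg J sJ); exact: pf. Qed.

Lemma primitive_content_le1 A f g : coefs_in A f -> primitive A g -> content_le A f g.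
Proof.
move=> Af pg J sJ Jg i; rewrite -[f`_i]mulr1; case: (sJ) => _ _; apply; first exact: Af.
exact: pg Jg.
Qed.

Section Valring.
Variable V : set K.
Hypothesis vV : valring V.

Let sV : is_subring V. Proof. by case: vV. Qed.
Let sN := nonunits_submodule vV.

(** Finitely many elements generate a principal [V]-module, namely by one of least value.
    Quantifying over [J] says this without naming the generated module. *)
Lemma principal_submodule (l : seq K) : exists d, forall J, submodule V J ->
  (forall x, x \in l -> J x) <-> J d.
Proof.
elim: l => [|x l [d IHd]].
  by exists 0 => J [J0 _ _]; split.
have dvd y z J : submodule V J -> V (y / z) -> z != 0 -> J z -> J y.
  by case=> _ _ JM Vyz z0 Jz; rewrite -(mulfVK z0 y); exact: JM.
have two J : submodule V J ->
    (forall y, y \in x :: l -> J y) <-> J x /\ J d.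
  move=> sJ; split=> [Jl|[Jx Jd] y].
    split; first by apply: Jl; rewrite mem_head.
    by apply/IHd => // y yl; apply: Jl; rewrite inE yl orbT.
  by rewrite inE => /predU1P[->//|]; move: y; apply/IHd.
have [d0|d0] := eqVneq d 0.
  exists x => J sJ; rewrite (two J sJ); split=> [[]//|Jx]; split=> //.
  by rewrite d0; case: sJ.
have [x0|x0] := eqVneq x 0.
  exists d => J sJ; rewrite (two J sJ); split=> [[]//|Jd]; split=> //.
  by rewrite x0; case: sJ.
have [Vxd|Vdx] : V (x / d) \/ V (d / x).
  by case: vV => _ /(_ (x / d)); rewrite invf_div.
- exists d => J sJ; rewrite (two J sJ); split=> [[]//|Jd]; split=> //.
  exact: dvd Jd.
- exists x => J sJ; rewrite (two J sJ); split=> [[]//|Jx]; split=> //.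
  exact: dvd Jx.
Qed.

Lemma principal_content f : exists d, forall J, submodule V J ->
  coefs_in J f <-> J d.
Proof.
have [d Pd] := principal_submodule f; exists d => J sJ; rewrite -(Pd J sJ).
split=> [Jf x /(nthP 0)[i _ <-]|Jf i]; first exact: Jf.
have [/(mem_nth 0)/Jf//|/(nth_default 0)->] := ltnP i (size f).
by case: sJ.
Qed.

Lemma content_le_total f g : content_le V f g \/ content_le V g f.
Proof.
have [d Pd] := principal_content f; have [e Pe] := principal_content g.
have dvd y z J : submodule V J -> V (y / z) -> z != 0 -> J z -> J y.
  by case=> _ _ JM Vyz z0 Jz; rewrite -(mulfVK z0 y); exact: JM.
have [d0|d0] := eqVneq d 0.
  by left=> J sJ _; apply/Pd => //; rewrite d0; case: sJ.
have [e0|e0] := eqVneq e 0.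
  by right=> J sJ _; apply/Pe => //; rewrite e0; case: sJ.
have [Vde|Ved] : V (d / e) \/ V (e / d).
  by case: vV => _ /(_ (d / e)); rewrite invf_div.
- by left=> J sJ /(Pe J sJ) Je; apply/(Pd J sJ); exact: dvd Je.
- by right=> J sJ /(Pd J sJ) Jd; apply/(Pe J sJ); exact: dvd Jd.
Qed.

Lemma primitive_part f : f != 0 -> exists d f0,
  [/\ d != 0, f = d *: f0, coefs_in V f0 & primitive V f0].
Proof.
move=> f0; have [d Pd] := principal_content f.
have d0 : d != 0.
  apply: contra_neq f0 => d0; apply/polyP => i; rewrite coef0.
  suff : coefs_in [set 0] f by apply.
  by apply/Pd => //; exact: submodule_set0.
have fE : f = d *: (d^-1 *: f) by rewrite scalerA mulfV // scale1r.
have coefE J : coefs_in [set x | exists2 c, J c & x = c * d] f <-> coefs_in J (d^-1 *: f).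
  split=> Jf i; last by exists (d^-1 *: f)`_i; rewrite // {1}fE coefZ mulrC.
  by rewrite coefZ; have [c Jc ->] := Jf i; rewrite mulrC mulfK.
exists d, (d^-1 *: f); split=> //.
  apply/coefE/Pd; first exact: (submodule_scale _ (submodule_self sV)).
  by exists 1; [exact: sub_1|rewrite mul1r].
move=> J sJ /coefE/Pd; move=> /(_ (submodule_scale _ sJ)) [c Jc dE].
suff <- : c = 1 by [].
by apply: (mulIf d0); rewrite -dE mul1r.
Qed.

Lemma primitive_unit g : coefs_in V g -> primitive V g <-> ~ coefs_in (nonunits V) g.
Proof.
move=> Vg; split=> [pg Ng|nNg]; first by apply: (nonunits1 vV); exact: pg Ng.
apply: (primitive_maximal sV) => // M maxM Mg; apply: nNg => i.
by rewrite -(max_idealE vV); exists M.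
Qed.

(** [V(t)] is the Gauss extension of [V]: membership compares contents, for any representation of
    the fraction. Forwards, [f * g1 = f1 * h] with [g1] primitive, and by Gauss's lemma multiplying
    by [g1] leaves the content of [f] unchanged. *)
Lemma nagata_content f h : h != 0 ->
  nagata V (tofrac f / tofrac h) <-> content_le V f h.
Proof.
move=> h0; split=> [/(nagataP _ sV)[f1 [g1 [Vf1 Vg1 pg1 E]]] J sJ Jh|fh].
  have fgE : f * g1 = f1 * h.
    apply/eqP; rewrite -tofrac_eq !tofracM.
    have g10 := primitive_neq0 pg1.
    by move/eqP: E; rewrite eqr_div ?tofrac_eq0.
  have : coefs_in J (f * g1) by rewrite fgE; exact: (coefsM sV sJ).
  have [->|f0] := eqVneq f 0; first by move=> _ i; rewrite coef0; case: sJ.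
  have [d [f2 [d0 -> Vf2 pf2]]] := primitive_part f0; rewrite -scalerAl => Jd.
  have sJd : submodule V [set x | J (d * x)].
    case: sJ => J0 JD JM; split=> /=; first by rewrite mulr0.
      by move=> x y Jx Jy; rewrite mulrDr; exact: JD.
    by move=> a x Va Jx; rewrite mulrCA; exact: JM.
  have /(_ _ sJd) : primitive V (f2 * g1) by exact: primitiveM.
  rewrite /= mulr1 => JD i; rewrite coefZ mulrC; case: (sJ) => _ _; apply=> //.
  by apply: JD => j /=; have := Jd j; rewrite coefZ.
have [d [h' [d0 hE Vh' ph']]] := primitive_part h0.
apply/(nagataP _ sV); exists (d^-1 *: f), h'; split=> //.
  move=> i; rewrite coefZ.
  have [|c Vc ->] := fh _ (submodule_scale d (submodule_self sV)) _ i.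
    by move=> j; exists h'`_j; rewrite // hE coefZ mulrC.
  by rewrite mulrC mulfK.
apply/eqP; rewrite eqr_div ?tofrac_eq0 ?(primitive_neq0 ph') //.
by rewrite -!tofracM tofrac_eq hE -scalerAr -scalerAl scalerA mulfV // scale1r.
Qed.

Lemma nagata_valring : valring (nagata V).
Proof.
split=> [|x]; first exact: nagata_subring.
have [f [h [h0 ->]]] := fracP x.
have [->|f0] := eqVneq f 0.
  by left; rewrite tofrac0 mul0r; exact: (sub_0 (nagata_subring sV)).
rewrite invf_div; have [fh|hf] := content_le_total f h.
  by left; apply/nagata_content.
by right; apply/nagata_content.
Qed.

Lemma nonunits_nagata f g : coefs_in V f -> coefs_in V g -> primitive V g ->
  nonunits (nagata V) (tofrac f / tofrac g) <-> coefs_in (nonunits V) f.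
Proof.
move=> Vf Vg pg; have g0 := primitive_neq0 pg.
have [->|f0] := eqVneq f 0.
  split=> _; last by left; rewrite tofrac0 mul0r.
  by move=> i; rewrite coef0; left.
split=> [|Nf].
  apply: contraPP => /(primitive_unit Vf) pf; apply/nonunitsN.
  rewrite mulf_neq0 ?invr_eq0 ?tofrac_eq0 // invf_div; split=> //.
  by apply/nagata_content => //; exact: primitive_content_le1.
apply: contrapT => /nonunitsN[_]; rewrite invf_div => /(nagata_content _ f0) gf.
by apply: (nonunits1 vV); apply: pg => //; apply: gf.
Qed.

End Valring.

(** * Contraction from [K(t)] to [K], and the Kronecker function ring *)

Definition constants (U : set {fraction {poly K}}) : set K := [set a | U (tofrac a%:P)].

Lemma constants_subring U : is_subring U -> is_subring (constants U).
Proof.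
move=> sU; apply/is_subringP; rewrite /constants; split=> /=.
- by rewrite tofrac1; exact: sub_1.
- by move=> x y Ux Uy; rewrite polyCB tofracB; exact: sub_B.
- by move=> x y Ux Uy; rewrite polyCM tofracM; exact: sub_M.
Qed.

Lemma tofrac_polyCV a : tofrac (a^-1)%:P = (tofrac a%:P)^-1.
Proof.
have [->|a0] := eqVneq a 0; first by rewrite invr0 tofrac0 invr0.
have a0' : tofrac a%:P != 0 by rewrite tofrac_eq0 polyC_eq0.
by apply: (mulfI a0'); rewrite mulfV // -tofracM -polyCM mulfV // tofrac1.
Qed.

Lemma constants_valring U : valring U -> valring (constants U).
Proof.
move=> [sU totU]; split=> [|x]; first exact: constants_subring.
by rewrite /constants /= tofrac_polyCV; exact: totU.
Qed.

Lemma nonunits_constants U : nonunits (constants U) = constants (nonunits U).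
Proof.
apply/seteqP; rewrite /nonunits /constants; split=> a /=; rewrite tofrac_polyCV.
  by case=> [->|]; [left; rewrite tofrac0|right].
by case=> [/eqP|]; [rewrite tofrac_eq0 polyC_eq0 => /eqP; left|right].
Qed.

Lemma submodule_tofrac (U J : set {fraction {poly K}}) f : is_subring U -> submodule U J -> U (tofrac 'X) ->
  coefs_in (constants J) f -> J (tofrac f).
Proof.
move=> sU sJ UX Jf; rewrite -[f]coefK poly_def rmorph_sum /=.
apply: (submodule_sum sJ) => i _; rewrite -mul_polyC tofracM mulrC tofracXn.
by case: (sJ) => _ _; apply; [exact: sub_X|exact: Jf].
Qed.

(** A form of the Kronecker function ring without centering condition or integral closure;
    [kroneckerE] shows that it is the same ring. *)
Definition kron D : set {fraction {poly K}} :=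
  [set x | forall V, valring V -> D `<=` V -> nagata V x].

Lemma valuation_overringE D V : is_subring D -> quotient_field D = setT ->
  valuation_overring D V <-> valring V /\ D `<=` V.
Proof.
move=> sD qD; split=> [[[sV DV _] [_ totV]]|[[sV totV] DV]].
  split=> //; split=> // x; apply: totV.
  have [a [b [Da Db b0 ->]]] : quotient_field D x by rewrite qD.
  by exists a, b; split=> //; exact: DV.
have qV x : quotient_field V x.
  have [a [b [Da Db b0 ->]]] : quotient_field D x by rewrite qD.
  by exists a, b; split=> //; exact: DV.
by split; split=> //; rewrite qD.
Qed.

Lemma integral_closureP D x : is_subring D -> quotient_field D = setT ->
  integral_closure D x <-> forall V, valring V -> D `<=` V -> V x.
Proof.
move=> sD qD; rewrite -(integral_overP x sD) /integral_closure /= qD.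
by split=> [[]|].
Qed.

Lemma integral_closure_subring D : is_subring D -> quotient_field D = setT ->
  is_subring (integral_closure D).
Proof.
move=> sD qD; apply/is_subringP; split.
- by apply/(integral_closureP _ sD qD) => V [sV _] _; exact: sub_1.
- move=> x y /(integral_closureP _ sD qD) Dx /(integral_closureP _ sD qD) Dy.
  apply/(integral_closureP _ sD qD) => V vV DV; case: (vV) => sV _.
  by apply: sub_B => //; [exact: Dx|exact: Dy].
- move=> x y /(integral_closureP _ sD qD) Dx /(integral_closureP _ sD qD) Dy.
  apply/(integral_closureP _ sD qD) => V vV DV; case: (vV) => sV _.
  by apply: sub_M => //; [exact: Dx|exact: Dy].
Qed.

Lemma sub_integral_closure D : is_subring D -> quotient_field D = setT ->
  D `<=` integral_closure D.
Proof.
by move=> sD qD x Dx; apply/(integral_closureP _ sD qD) => V _; apply.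
Qed.

Lemma quotient_field_sub D B : D `<=` B -> quotient_field D = setT ->
  quotient_field B = setT.
Proof.
move=> DB qD; apply/seteqP; split=> // x _.
have [a [b [Da Db b0 ->]]] : quotient_field D x by rewrite qD.
by exists a, b; split=> //; exact: DB.
Qed.

(** Valuation rings over [D] contain its integral closure, and each of them contains a centered one
    [W] by [valring_dominating]; the smaller ring [W(t)] then controls [V(t)]. *)
Lemma kroneckerE D : is_subring D -> quotient_field D = setT ->
  kronecker (integral_closure D) = kron D.
Proof.
move=> sD qD; set E := integral_closure D.
have sE : is_subring E by exact: integral_closure_subring.
have DE : D `<=` E by exact: sub_integral_closure.
have qE : quotient_field E = setT by exact: quotient_field_sub qD.
apply/seteqP; split=> [x xE V vV DV|x xD V /= [/(valuation_overringE V sE qE)[vV EV] _]].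
  have EV : E `<=` V by exact: valring_integral_closure.
  have [W [vW EW WV _ maxW]] := valring_dominating sE vV EV.
  have [sW _] := vW; have [sV _] := vV.
  apply: (nagata_sub sW sV WV); apply: xE; split.
    exact/valuation_overringE.
  by rewrite /centered_on_maximal max_idealE.
by apply: xD => //; exact: subset_trans EV.
Qed.

Lemma kron_subring D : is_subring (kron D).
Proof.
apply/is_subringP; split.
- by move=> V [sV _] _; exact: (sub_1 (nagata_subring sV)).
- move=> x y Dx Dy V vV DV; case: (vV) => sV _; apply: sub_B; first exact: nagata_subring.
    exact: Dx.
  exact: Dy.
- move=> x y Dx Dy V vV DV; case: (vV) => sV _; apply: sub_M; first exact: nagata_subring.
    exact: Dx.
  exact: Dy.
Qed.

Lemma kron_content D f h : h != 0 ->
  (forall V, valring V -> D `<=` V -> content_le V f h) ->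
  kron D (tofrac f / tofrac h).
Proof. by move=> h0 fh V vV DV; apply/nagata_content => //; exact: fh. Qed.

End Nagata.

(** * Combinations avoiding finitely many ideals *)

Section Combination.
Variables (K : fieldType) (D : set K).
Hypothesis sD : is_subring D.
Implicit Types (A E V I J M N P : set K) (x y a b d u : K) (f g h : {poly K}).

Lemma maximal_ideal_sub M x : maximal_ideal D M -> M x -> D x.
Proof. by case=> -[+ _ _ _] _ _; apply. Qed.

Lemma comaximal M N : maximal_ideal D M -> maximal_ideal D N -> M <> N ->
  exists2 z, N z & M (z - 1).
Proof.
move=> [iM nM1 maxM] [iN nN1 maxN] neqMN.
have [MD M0 MA MM] := iM; have [ND N0 NA NM] := iN.
have sM := ideal_submodule iM.
pose J := [set z | exists m n, [/\ M m, N n & z = m + n]].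
have MJ : M `<=` J by move=> m Mm; exists m, 0; rewrite addr0.
have NJ : N `<=` J by move=> n Nn; exists 0, n; rewrite add0r.
have iJ : is_ideal D J.
  split; first by move=> _ [m [n [/MD Dm /ND Dn ->]]]; exact: sub_D.
  - exact: MJ.
  - move=> _ _ [m [n [Mm Nn ->]]] [m' [n' [Mm' Nn' ->]]].
    by exists (m + m'), (n + n'); split; [exact: MA|exact: NA|rewrite addrACA].
  - move=> c _ Dc [m [n [Mm Nn ->]]].
    by exists (c * m), (c * n); split; [exact: MM|exact: NM|rewrite mulrDr].
have [[m [n [Mm Nn E]]]|nJ1] := pselect (J 1); last first.
  by case: neqMN; rewrite -(maxM J iJ nJ1 MJ) (maxN J iJ nJ1 NJ).
exists n => //; have -> : n - 1 = - m by rewrite E; ring.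
exact: (submodule_N sD sM).
Qed.

Lemma coprime_one (l : seq (set K)) M : maximal_ideal D M ->
  (forall N, N \in l -> maximal_ideal D N) -> M \notin l ->
  exists c, [/\ D c, M (c - 1) & forall N, N \in l -> N c].
Proof.
move=> maxM; have [iM _ _] := maxM; have sM := ideal_submodule iM.
have [MD M0 MA MM] := iM.
elim: l => [|N l IHl] maxl; first by exists 1; split=> //; [exact: sub_1|rewrite subrr].
rewrite inE negb_or => /andP[/eqP neqMN /IHl[N' N'l|c [Dc Mc lc]]].
  by apply: maxl; rewrite inE N'l orbT.
have maxN : maximal_ideal D N by apply: maxl; rewrite mem_head.
have [z Nz Mz] := comaximal maxM maxN neqMN.
have Dz := maximal_ideal_sub maxN Nz; exists (c * z); split.
- exact: sub_M.
- have -> : c * z - 1 = c * (z - 1) + (c - 1) by ring.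
  by apply: MA => //; exact: MM.
- move=> N'; rewrite inE => /predU1P[->|/[dup] N'l /lc N'c].
    by case: maxN => -[_ _ _ NM] _ _; exact: NM.
  rewrite mulrC; have [|[_ _ _ NM] _ _] := maxl N'; last exact: NM.
  by rewrite inE N'l orbT.
Qed.

Lemma chinese_remainder (l : seq (set K)) (a : set K -> K) :
  (forall M, M \in l -> maximal_ideal D M /\ D (a M)) ->
  exists2 c, D c & forall M, M \in l -> M (c - a M).
Proof.
elim: l => [|M l IHl] maxl; first by exists 0 => //; exact: sub_0.
have [N Nl|c Dc lc] := IHl; first by apply: maxl; rewrite inE Nl orbT.
have [maxM Da] := maxl M (mem_head _ _).
(* The list may repeat an ideal; this is harmless because the target [a M] depends on the ideal
   alone. *)
have [Ml|nMl] := boolP (M \in l).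
  by exists c => // N; rewrite inE => /predU1P[->|]; exact: lc.
have [|e [De Me le]] := coprime_one maxM _ nMl.
  by move=> N Nl; case: (maxl N) => //; rewrite inE Nl orbT.
exists (c + e * (a M - c)); first by apply: sub_D => //; apply: sub_M => //; exact: sub_B.
move=> N; rewrite inE => /predU1P[->|Nl].
  have -> : c + e * (a M - c) - a M = (a M - c) * (e - 1) by ring.
  by case: maxM => -[_ _ _ MM] _ _; apply: MM => //; exact: sub_B.
have [|[[_ _ NA NM] _ _] _] := maxl N; first by rewrite inE Nl orbT.
have -> : c + e * (a M - c) - a N = (c - a N) + (a M - c) * e by ring.
by apply: NA; [exact: lc|apply: NM; [exact: sub_B|exact: le]].
Qed.

Lemma residue_representatives M n : is_ideal D M -> `I_n #<= residue_field D M ->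
  exists u : 'I_n -> K, (forall i, D (u i)) /\ forall i j, i != j -> ~ M (u i - u j).
Proof.
move=> iM /pcard_leP[f]; have sM := ideal_submodule iM; have [_ _ MA _] := iM.
have /choice[u Pu] : forall i : 'I_n, exists x, D x /\ f i = coset D M x.
  move=> i; have [x Dx <-] : residue_field D M (f i) by apply: funS; exact: ltn_ord.
  by exists x.
exists u; split=> [i|i j]; first by case: (Pu i).
apply: contra_neqP => /contrapT Mij; apply: val_inj.
suff : f i = f j by apply: (@inj _ _ `I_n f); rewrite inE /=.
have [_ ->] := Pu i; have [_ ->] := Pu j.
apply/seteqP; split=> z [Dz Mz]; split=> //.
  have -> : z - u j = (z - u i) + (u i - u j) by ring.
  exact: MA.
have -> : z - u i = (z - u j) - (u i - u j) by ring.
exact: (submodule_B sD sM).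
Qed.

Variable s : nat.
Hypothesis residues : forall M, maximal_ideal D M -> `I_s.+1 #<= residue_field D M.

(* A projective line over a residue field [D / M] has at least [s + 2] points, *)
(* and each test [N j] rules out at most one of them.                          *)
Lemma avoiding_point (T : finType) (N : T -> set K) M x y :
  (#|T| <= s.+1)%N -> maximal_ideal D M -> (forall j, submodule D (N j)) ->
  (forall j c z, D c -> ~ M c -> z = x \/ z = y -> N j (c * z) -> N j z) ->
  exists a b, [/\ D a, D b & forall j a' b', D a' -> D b' -> M (a' - a) ->
    M (b' - b) -> N j (a' * x + b' * y) -> N j x /\ N j y].
Proof.
move=> cardT maxM sN Nreg; have [iM nM1 _] := maxM.
have [u [Du nMu]] := residue_representatives iM (residues maxM).
have sM := ideal_submodule iM; have [MD _ MA MM] := iM.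
(* The points [(1 : u_i)] and [(0 : 1)]: [s + 2] in number and pairwise distinct modulo [M]. *)
pose pt (c : option 'I_s.+1) : K * K := if c is Some i then (1, u i) else (0, 1).
have Dpt c : D (pt c).1 /\ D (pt c).2.
  by case: c => [i|]; split=> //=; [exact: sub_1|exact: sub_0|exact: sub_1].
have nMpt c c' : c != c' -> ~ M ((pt c).1 * (pt c').2 - (pt c').1 * (pt c).2).
  case: c c' => [i|] [j|] //= neq_cc'.
  - rewrite !mul1r; apply: nMu; by apply: contra_neq neq_cc' => ->.
  - by rewrite mulr1 mul0r subr0.
  - rewrite mul0r mulr1 sub0r => MN1; apply: nM1; rewrite -[1]opprK.
    exact: (submodule_N sD sM).
apply: contrapT => nex.
have /choice[bad Pbad] : forall c, exists j, exists a b, [/\ D a, D b, M (a - (pt c).1),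
    M (b - (pt c).2) & N j (a * x + b * y) /\ ~ (N j x /\ N j y)].
  move=> c; apply: contrapT => nbad; apply: nex.
  exists (pt c).1, (pt c).2; have [D1 D2] := Dpt c; split=> // j a b Da Db Ma Mb Nab.
  by apply: contrapT => nNxy; apply: nbad; exists j, a, b.
have inj_bad : injective bad.
  move=> c c' Ebad; apply: contrapT => /eqP neq_cc'.
  have [a [b [Da Db Ma Mb [Nab nNxy]]]] := Pbad c.
  have [a' [b' [Da' Db' Ma' Mb' [+ _]]]] := Pbad c'; rewrite -Ebad => Nab'.
  have [Dc1 Dc2] := Dpt c; have [Dc1' Dc2'] := Dpt c'.
  (* Cramer's rule: if one test rejects two distinct points, their determinant [e] is outside [M],
     and [e * x], [e * y] are combinations of the two rejected values. Cancelling [e] puts [x] and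
     [y] in [N]. *)
  pose e := a * b' - a' * b.
  have De : D e by apply: sub_B => //; exact: sub_M.
  have nMe : ~ M e.
    move=> Me; apply: (nMpt _ _ neq_cc').
    have -> : (pt c).1 * (pt c').2 - (pt c').1 * (pt c).2 = e
      - (b' * (a - (pt c).1) + (pt c).1 * (b' - (pt c').2)
         - (b * (a' - (pt c').1) + (pt c').1 * (b - (pt c).2))) by rewrite /e; ring.
    apply: (submodule_B sD sM) => //; apply: (submodule_B sD sM).
      by apply: MA; apply: MM.
    by apply: MA; apply: MM.
  have sNj := sN (bad c); have [_ _ NM] := sNj.
  apply: nNxy; split; apply: (Nreg _ e) => //; [by left| |by right|].
  - have -> : e * x = b' * (a * x + b * y) - b * (a' * x + b' * y) by rewrite /e; ring.
    by apply: (submodule_B sD sNj); apply: NM.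
  - have -> : e * y = a * (a' * x + b' * y) - a' * (a * x + b * y) by rewrite /e; ring.
    by apply: (submodule_B sD sNj); apply: NM.
have := leq_trans (leq_card _ inj_bad) cardT.
by rewrite card_option card_ord ltnn.
Qed.

(** Each test is attached to its own maximal ideal of [D]. A point is chosen for every ideal
    separately; since [avoiding_point] tolerates changes of the coordinates modulo that ideal, the
    Chinese remainder theorem glues the choices. *)
Lemma avoiding_combination (T : finType) (N M : T -> set K) x y :
  (#|T| <= s.+1)%N -> (forall j, maximal_ideal D (M j)) ->
  (forall j, submodule D (N j)) ->
  (forall j c z, D c -> ~ M j c -> z = x \/ z = y -> N j (c * z) -> N j z) ->
  exists a b, [/\ D a, D b & forall j, N j (a * x + b * y) -> N j x /\ N j y].
Proof.
move=> cardT maxM sN Nreg.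
(* Tests attached to other ideals are replaced by the whole field, where the requirement holds
   trivially. *)
pose N' X j : set K := if `[< M j = X >] then N j else setT.
have sN' X j : submodule D (N' X j) by rewrite /N'; case: asboolP.
have /choice[p Pp] : forall X : set K, exists p : K * K, (exists j, M j = X) ->
    [/\ D p.1, D p.2 & forall j a' b', D a' -> D b' -> X (a' - p.1) ->
    X (b' - p.2) -> N' X j (a' * x + b' * y) -> N' X j x /\ N' X j y].
  move=> X; have [[j jX]|nj] := pselect (exists j, M j = X); last first.
    by exists (0, 0) => /nj.
  have [||a [b Pab]] := @avoiding_point T (N' X) X x y cardT _ (sN' X).
  - by rewrite -jX.
  - move=> i c z; rewrite /N'; case: asboolP => // <-; exact: Nreg.
  by exists (a, b).
have Pp' j : D (p (M j)).1 /\ D (p (M j)).2 by have [] := Pp (M j) (ex_intro _ j erefl).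
have maxl (q : K * K -> K) : (forall j, D (q (p (M j)))) ->
    forall X, X \in [seq M j | j : T] -> maximal_ideal D X /\ D (q (p X)).
  by move=> Dq X /mapP[j _ ->]; split.
have [|a Da Ma] := chinese_remainder (maxl fst _); first by move=> j; case: (Pp' j).
have [|b Db Mb] := chinese_remainder (maxl snd _); first by move=> j; case: (Pp' j).
exists a, b; split=> // j Nj; have jM : M j \in [seq M j | j : T] by apply: map_f; rewrite mem_enum.
have [_ _ /(_ j a b Da Db (Ma _ jM) (Mb _ jM))] := Pp (M j) (ex_intro _ j erefl).
by rewrite /N'; case: asboolP => // _; apply.
Qed.

Variable E : set K.
Hypothesis sE : is_subring E.
Hypothesis DE : D `<=` E.
Hypothesis cardE : maximal_ideals E #= `I_s.

Lemma maximal_ideal_enum : exists e : 'I_s -> set K,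
  (forall i, maximal_ideal E (e i)) /\ forall M, maximal_ideal E M -> exists i, e i = M.
Proof.
move: cardE; rewrite card_eq_sym => /pcard_eqP[f].
exists (fun i => f i); split=> [i|M maxM].
  by have : maximal_ideals E (f i) by apply: funS; exact: ltn_ord.
have [i lt_is fi] := 'surj_f maxM.
by exists (Ordinal lt_is).
Qed.

Lemma maximal_over (N : set K) : submodule D N -> ~ N 1 ->
  exists2 M, maximal_ideal D M & D `&` N `<=` M.
Proof.
by move=> sN nN1; apply: ideal_in_maximal; [exact: ideal_submoduleI|case].
Qed.

Section OverValring.
Variable V : set K.
Hypotheses (vV : valring V) (DV : D `<=` V).

(** There are [s + 1] tests: the [s] maximal ideals of [E], and the module [m_V * w], where [w] is
    whichever of [x], [y] has the smaller value. Passing the last one means that [d] has the value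
    of [w]. *)
Lemma unit_combination2 x y : E x -> E y -> exists d,
  [/\ forall J, submodule D J -> J x -> J y -> J d,
      forall J, submodule V J -> J d -> J x /\ J y
    & forall N, maximal_ideal E N -> N d -> N x /\ N y].
Proof.
move=> Ex Ey; have [sV _] := vV; have [e [maxe sure]] := maximal_ideal_enum.
have [w [wxy Vx Vy]] : exists w, [/\ w = x \/ w = y, exists2 c, V c & x = c * w
    & exists2 c, V c & y = c * w].
  have [x0|x0] := eqVneq x 0.
    exists y; split; first by right.
      by exists 0; [exact: sub_0|rewrite mul0r].
    by exists 1; [exact: sub_1|rewrite mul1r].
  have [y0|y0] := eqVneq y 0.
    exists x; split; first by left.
      by exists 1; [exact: sub_1|rewrite mul1r].
    by exists 0; [exact: sub_0|rewrite mul0r].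
  case: (vV) => _ /(_ (x / y)); rewrite invf_div => -[Vxy|Vyx].
    exists y; split; first by right.
      by exists (x / y) => //; rewrite divfK.
    by exists 1; [exact: sub_1|rewrite mul1r].
  exists x; split; first by left.
    by exists 1; [exact: sub_1|rewrite mul1r].
  by exists (y / x) => //; rewrite divfK.
pose N0 := [set z | exists2 c, nonunits V c & z = c * w].
pose N (j : option 'I_s) := if j is Some i then e i else N0.
have se i : submodule D (e i).
  by case: (maxe i) => iei _ _; apply: submodule_sub (ideal_submodule iei).
(* Each test gets a maximal ideal of [D] above its contraction; scalars outside it can then be
   cancelled, as [avoiding_combination] demands. *)
have /choice[M PM] : forall j : option 'I_s, exists M, maximal_ideal D M /\
    D `&` (if j is Some i then e i else nonunits V) `<=` M.
  move=> [i|].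
    have [|M maxM NM] := maximal_over (se i); last by exists M.
    by case: (maxe i).
  have [||M maxM NM] := @maximal_over (nonunits V); last by exists M.
    exact: submodule_sub (nonunits_submodule vV).
  exact: nonunits1.
have [| | | |a [b [Da Db Nab]]] := @avoiding_combination _ N M x y.
- by rewrite card_option card_ord.
- by move=> j; case: (PM j).
- move=> [i|]; first exact: se.
  exact: submodule_sub DV (submodule_scale w (nonunits_submodule vV)).
- move=> [i|] c z Dc nMc zxy /=.
    have [_ _ primei] := maximal_ideal_prime sE (maxe i).
    have Ez : E z by case: zxy => ->.
    have [_ NM] := PM (Some i).
    move=> /primei[]//; first exact: DE.
    by move=> eic; case: nMc; apply: NM.
  have [_ NM] := PM None.
  have /nonunitsN[c0 Vc] : ~ nonunits V c by move=> Nc; apply: nMc; exact: NM.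
  case=> c' Nc' E'; exists (c^-1 * c').
    by case: (nonunits_submodule vV) => _ _; apply.
  by rewrite -mulrA -E' mulKf.
exists (a * x + b * y); split.
- by move=> J [_ JA JM] Jx Jy; apply: JA; apply: JM.
- move=> J sJ Jd; suff Jw : J w.
    by case: (sJ) => _ _ JM; case: Vx Vy => [c Vc ->] [c' Vc' ->]; split; exact: JM.
  have [w0|w0] := eqVneq w 0; first by rewrite w0; case: sJ.
  have nN0w : ~ N0 w.
    case=> c Nc E'; apply: (nonunits1 vV); suff <- : c = 1 by [].
    by apply: (mulIf w0); rewrite -E' mul1r.
  have nN0d : ~ N0 (a * x + b * y).
    by move=> /(Nab None)[]; case: wxy => <-.
  have /nonunitsN[dw0 Vdw] : ~ nonunits V ((a * x + b * y) / w).
    by move=> Nd; apply: nN0d; exists ((a * x + b * y) / w) => //; rewrite divfK.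
  case: (sJ) => _ _ JM; have := JM _ _ Vdw Jd.
  rewrite invf_div mulfVK //; apply: contra_neq dw0 => ->; exact: mul0r.
- by move=> X /sure[i <-]; exact: (Nab (Some i)).
Qed.

Lemma unit_combination_seq (l : seq K) : (forall x, x \in l -> E x) -> exists d,
  [/\ forall J, submodule D J -> (forall x, x \in l -> J x) -> J d,
      forall J, submodule V J -> J d -> forall x, x \in l -> J x
    & forall N, maximal_ideal E N -> N d -> forall x, x \in l -> N x].
Proof.
elim: l => [|y l IHl] El; first by exists 0; split=> // J [].
have [x xl|d [Dd Vd Nd]] := IHl; first by apply: El; rewrite inE xl orbT.
have Ed : E d.
  apply: Dd; first exact: submodule_sub DE (submodule_self sE).
  by move=> x xl; apply: El; rewrite inE xl orbT.
have [d' [Dd' Vd' Nd']] := unit_combination2 (El y (mem_head _ _)) Ed.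
exists d'; split.
- move=> J sJ Jl; apply: Dd' => //; first by apply: Jl; rewrite mem_head.
  by apply: Dd => // x xl; apply: Jl; rewrite inE xl orbT.
- move=> J sJ /(Vd' J sJ)[Jy Jd] x; rewrite inE => /predU1P[->//|].
  exact: Vd.
- move=> N maxN /(Nd' N maxN)[Ny Nd''] x; rewrite inE => /predU1P[->//|].
  exact: Nd.
Qed.

Lemma unit_combination g : coefs_in E g -> exists d,
  [/\ forall J, submodule D J -> coefs_in J g -> J d,
      forall J, submodule V J -> J d -> coefs_in J g
    & forall N, maximal_ideal E N -> N d -> coefs_in N g].
Proof.
move=> Eg; have coefsE (J : set K) : J 0 -> coefs_in J g <-> forall x, x \in (g : seq K) -> J x.
  move=> J0; split=> [Jg x /(nthP 0)[i _ <-]|Jg i]; first exact: Jg.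
  by have [/(mem_nth 0)/Jg//|/(nth_default 0)->] := ltnP i (size g).
have [|d [Dd Vd Nd]] := @unit_combination_seq g; first by apply/coefsE => //; exact: sub_0.
exists d; split.
- by move=> J sJ /coefsE Jg; apply: Dd => //; apply: Jg; case: sJ.
- by move=> J sJ Jd; apply/coefsE; [case: sJ|exact: Vd].
- by move=> N maxN Nd'; apply/coefsE; [case: maxN => -[]|exact: Nd].
Qed.

Lemma nonmaximal_unit d : E d -> (forall N, maximal_ideal E N -> ~ N d) ->
  d != 0 /\ E d^-1.
Proof.
move=> Ed nN; have sI := submodule_scale d (submodule_self sE).
set I := [set x | _] in sI.
have iI : is_ideal E I by case: sI => *; split=> // _ [c Ec ->]; exact: sub_M.
have [[c Ec E1]|nI1] := pselect (I 1); last first.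
  have [N maxN IN] := ideal_in_maximal iI nI1; case: (nN N maxN); apply: IN.
  by exists 1; [exact: sub_1|rewrite mul1r].
have d0 : d != 0.
  by apply/eqP => d0; move/eqP: E1; rewrite d0 mulr0 oner_eq0.
by split=> //; suff <- : c = d^-1 by []; apply: (mulIf d0); rewrite -E1 mulVf.
Qed.

Variable A : set K.
Hypotheses (sA : is_subring A) (DA : D `<=` A) (AE : A `<=` E).
Hypothesis unitAE : forall d, A d -> E d^-1 -> A d^-1.

Lemma subringI (B C : set K) : is_subring B -> is_subring C -> is_subring (B `&` C).
Proof.
move=> sB sC; apply/is_subringP; split.
- by split; exact: sub_1.
- by move=> x y [Bx Cx] [By Cy]; split; exact: sub_B.
- by move=> x y [Bx Cx] [By Cy]; split; exact: sub_M.
Qed.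

(** If [d] lay in a maximal ideal of [E], so would all coefficients of [g], and hence 1. So [d] is a
    unit of [E], and [unitAE] moves its inverse to [A]. *)
Lemma primitive_combination g : coefs_in A g -> primitive A g -> exists d,
  [/\ d != 0, A d, A d^-1, forall J, submodule D J -> coefs_in J g -> J d
    & forall J, submodule V J -> J d -> coefs_in J g].
Proof.
move=> Ag pg; have [d [Dd Vd Nd]] := unit_combination (coefs_in_sub AE Ag).
have Ad : A d by apply: Dd => //; exact: submodule_sub DA (submodule_self sA).
have [N maxN /(Nd N maxN) Ng|d0 Ed] := nonmaximal_unit (AE Ad).
  case: (maxN) => iN nN1 _; apply: nN1; apply: pg Ng.
  exact: submodule_sub AE (ideal_submodule iN).
by exists d; split=> //; exact: unitAE.
Qed.

(** Divide [f] and [g] by the [d] of [primitive_combination]. This is harmless over [A], where [d]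
    is a unit, and brings the coefficients into [V], where [d] generates the content of [g]. The
    hypotheses on [A] also hold for [E], so the result serves for both rings. *)
Lemma nagata_capV : nagata A `&` nagata V `<=` nagata (A `&` V).
Proof.
have [sV _] := vV; have sAV : is_subring (A `&` V) by exact: subringI.
move=> _ [/(nagataP _ sA)[f [g [Af Ag pg ->]]] /(nagata_content vV _ (primitive_neq0 pg)) fg].
have [d [d0 Ad Ad' Dd Vd]] := primitive_combination Ag pg.
have sVd := submodule_scale d (submodule_self sV).
have Vdg : coefs_in [set x | exists2 c, V c & x = c * d] g.
  by apply: Vd => //; exists 1; [exact: sub_1|rewrite mul1r].
have AVd h : coefs_in A h -> coefs_in [set x | exists2 c, V c & x = c * d] h ->
    coefs_in (A `&` V) (d^-1 *: h).
  move=> Ah Vh i; rewrite coefZ; split; first exact: sub_M.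
  by have [c Vc ->] := Vh i; rewrite mulrC mulfK.
apply/(nagataP _ sAV); exists (d^-1 *: f), (d^-1 *: g); split.
- by apply: AVd => //; exact: fg.
- exact: AVd.
(* Primitivity over the intersection survives because [d] is a combination of the coefficients of
   [g] over [D], which lies in both rings. *)
- move=> J sJ Jg; have sJD : submodule D J.
    by apply: submodule_sub sJ => x Dx; split; [exact: DA|exact: DV].
  have [|c Jc dE] := Dd _ (submodule_scale d sJD).
    by move=> i; exists (d^-1 *: g)`_i => //; rewrite coefZ mulrAC mulVf // mul1r.
  by suff <- : c = 1 by []; apply: (mulIf d0); rewrite -dE mul1r.
- have dp0 : tofrac (d^-1)%:P != 0 by rewrite tofrac_eq0 polyC_eq0 invr_eq0.
  by rewrite -!mul_polyC !tofracM -mulf_div divff // mul1r.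
Qed.

End OverValring.
End Combination.

(** * Localizations *)

Section Localization.
Variable F : fieldType.
Implicit Types (A P S : set F) (x y : F).

Lemma clear_denominators A S (f : {poly F}) : is_subring A -> S `<=` A -> S 1 ->
  (forall x y, S x -> S y -> S (x * y)) ->
  (forall i, exists2 c, S c & A (c * f`_i)) ->
  exists2 b, S b & coefs_in A (b *: f).
Proof.
move=> sA SA S1 SM Sf.
have [b Sb bl] : exists2 b, S b & forall x, x \in (f : seq F) -> A (b * x).
  have : forall x, x \in (f : seq F) -> exists2 c, S c & A (c * x).
    by move=> x /(nthP 0)[i _ <-]; exact: Sf.
  elim: (f : seq F) => [|x l IHl] Sl; first by exists 1.
  have [y yl|b Sb bl] := IHl; first by apply: Sl; rewrite inE yl orbT.
  have [c Sc Acx] := Sl x (mem_head _ _); exists (b * c); first exact: SM.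
  move=> y; rewrite inE => /predU1P[->|yl].
    by rewrite -mulrA; apply: sub_M => //; exact: SA.
  by rewrite mulrAC mulrC; apply: sub_M; [|exact: SA|exact: bl].
exists b => // i; rewrite coefZ.
have [/(mem_nth 0)/bl//|/(nth_default 0)->] := ltnP i (size f).
by rewrite mulr0; exact: sub_0.
Qed.

Lemma prime_complementM A P x y : prime_ideal A P -> A x -> A y -> ~ P x -> ~ P y ->
  ~ P (x * y).
Proof. by case=> _ _ PM Ax Ay nPx nPy /PM[]. Qed.

Lemma prime_complement_neq0 A P x : prime_ideal A P -> ~ P x -> x != 0.
Proof. by case=> -[_ P0 _ _] _ _ nPx; apply: contra_notN nPx => /eqP->. Qed.

Lemma localize_subring A P : is_subring A -> prime_ideal A P ->
  is_subring (localize A P).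
Proof.
move=> sA pP; apply/is_subringP; split.
- exists 1, 1; rewrite divr1; split=> //; try exact: sub_1.
  by case: pP.
- move=> _ _ [a [c [Aa Ac nPc ->]]] [a' [c' [Aa' Ac' nPc' ->]]].
  exists (a * c' - a' * c), (c * c'); split.
  + by apply: sub_B => //; exact: sub_M.
  + exact: sub_M.
  + exact: (prime_complementM pP).
  + rewrite -[in LHS]mulNr addf_div ?mulNr //; exact: (prime_complement_neq0 pP).
- move=> _ _ [a [c [Aa Ac nPc ->]]] [a' [c' [Aa' Ac' nPc' ->]]].
  exists (a * a'), (c * c'); split; try exact: sub_M.
  + exact: (prime_complementM pP).
  + by rewrite mulf_div.
Qed.

Lemma sub_localize A P : is_subring A -> prime_ideal A P -> A `<=` localize A P.
Proof.
move=> sA [_ nP1 _] a Aa; exists a, 1; rewrite divr1; split=> //; exact: sub_1.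
Qed.

Lemma localize_inv A P x : is_subring A -> A x -> ~ P x -> localize A P x^-1.
Proof. by move=> sA Ax nPx; exists 1, x; rewrite div1r; split=> //; exact: sub_1. Qed.

(* Modulo the nonunits of [W], the relation is an equation whose leading *)
(* coefficient is a unit of [U].                                         *)
Lemma valring_top_coef (U W : set F) (c : nat -> F) n y :
  valring U -> valring W -> nonunits W `<=` U -> W y ->
  (forall i, (i < n)%N -> U (c i)) ->
  (forall i, (i < n)%N -> nonunits W (c i) \/ U (c i)^-1) ->
  (exists2 i, (i < n)%N & ~ nonunits W (c i)) ->
  nonunits W (\sum_(i < n) c i * y ^+ i) -> U y.
Proof.
move=> vU vW NU Wy Uc Ucv [i0 lt_i0 nNi0] Nsum.
have [sU _] := vU; have [sW _] := vW; have sN := nonunits_submodule vW.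
pose P i := (i < n)%N && `[< ~ nonunits W (c i) >].
have P0 : P i0 by rewrite /P lt_i0; exact/asboolP.
have Pn i : P i -> (i <= n)%N by case/andP=> /ltnW.
(* [j] is the last index whose coefficient is not a nonunit of [W]; later terms disappear modulo the
   nonunits. *)
have [j /andP[lt_jn /asboolP nNj] max_j] := ex_maxnP (ex_intro _ i0 P0) Pn.
have Nhi (i : 'I_n) : (j < i)%N -> nonunits W (c i).
  move=> lt_ji; apply: contrapT => nNi; have /max_j : P i.
    by rewrite /P ltn_ord; exact/asboolP.
  by rewrite leqNgt lt_ji.
pose q := \poly_(i < j.+1) c i.
have Nq : nonunits W q.[y].
  have -> : q.[y] = \sum_(i < n) c i * y ^+ i - \sum_(i < n | ~~ (i < j.+1)%N) c i * y ^+ i.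
    rewrite [X in _ = X - _](bigID (fun i : 'I_n => (i < j.+1)%N)) /= addrK horner_poly.
    by rewrite (big_ord_widen _ (fun i => c i * y ^+ i) lt_jn).
  apply: (submodule_B sW sN) => //; apply: (submodule_sum sN) => i.
  rewrite -leqNgt => /Nhi Ni; rewrite mulrC; case: sN => _ _; apply => //.
  exact: sub_X.
have cj0 : c j != 0 by apply: contra_notN nNj => /eqP->; left.
case: j => [|j] in lt_jn nNj max_j Nhi q Nq cj0 *.
  by case: nNj; move: Nq; rewrite horner_poly big_ord1 expr0 mulr1.
have size_q : size q = j.+2 by rewrite size_poly_eq.
have size_c : (size (- (q.[y])%:P)%R < size q)%N.
  by rewrite size_polyN size_q (leq_ltn_trans (size_polyC_leq1 _)).
(* The value [q(y)] is a nonunit of [W], hence in [U]. Subtracting it makes [y] a root without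
   leaving [U], and the leading coefficient is still [c j], as the degree is positive. *)
have Uq : coefs_in U (q - (q.[y])%:P).
  move=> i; rewrite coefB coef_poly coefC; apply: sub_B => //.
    by case: ifP => lt_ij; [apply: Uc; exact: leq_ltn_trans lt_jn|exact: sub_0].
  by case: eqP => _; [exact: NU|exact: sub_0].
have := lead_coef_mul_root vU Uq; move=> /(_ y); rewrite lead_coefDl //.
rewrite /root hornerD hornerN hornerC subrr eqxx => /(_ isT).
rewrite lead_coefE size_q coef_poly ltnSn => Ucy.
rewrite -[y](mulKf cj0); apply: sub_M => //.
by case: (Ucv _ lt_jn).
Qed.

End Localization.

(** * The ring [kron D `&` nagata A] *)

Lemma div_common_denominator (F : fieldType) (x y z : F) :
  z != 0 -> x / z / (y / z) = x / y.
Proof. by move=> z0; rewrite invf_div mulrA divfK. Qed.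

Lemma tofrac_scale_div (K : fieldType) (c : K) (f g : {poly K}) : c != 0 ->
  tofrac (c *: f) / tofrac (c *: g) = tofrac f / tofrac g.
Proof.
move=> c0; have c0' : tofrac c%:P != 0 by rewrite tofrac_eq0 polyC_eq0.
by rewrite -!mul_polyC !tofracM -mulf_div (divff c0') mul1r.
Qed.

Lemma tofrac_image_subring (K : fieldType) (A : set K) : is_subring A ->
  is_subring [set tofrac f | f in coefs_in A].
Proof.
move=> sA; have sAA := submodule_self sA; apply/is_subringP; split.
- by exists 1; [exact: coefs1|exact: tofrac1].
- move=> _ _ [f Af <-] [g Ag <-]; exists (f - g); last exact: tofracB.
  by move=> i; rewrite coefB; exact: sub_B.
- move=> _ _ [f Af <-] [g Ag <-]; exists (f * g); last exact: tofracM.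
  exact: (coefsM sA sAA).
Qed.

(** [K[t]] is integrally closed. Write [y = a / b] in lowest terms. If [b] is not invertible in
    [K[t]], some valuation ring above has [b] as a nonunit; it contains [y], so [a = y * b] is a
    nonunit too, against Bezout. *)
Lemma polynomial_integrally_closed (K : fieldType) (y : {fraction {poly K}}) :
  (forall U, valring U -> [set tofrac f | f in coefs_in (@setT K)] `<=` U -> U y) ->
  exists q, y = tofrac q.
Proof.
pose P := [set tofrac f | f in coefs_in (@setT K)].
have sP : is_subring P by apply: tofrac_image_subring; apply/is_subringP; split.
have Pt (f : {poly K}) : P (tofrac f) by exists f.
move=> Uy; have [a0 [b0 [b00 yE0]]] := fracP y.
pose d := gcdp a0 b0; pose a := a0 %/ d; pose b := b0 %/ d.
have aE : a0 = a * d by rewrite divpK ?dvdp_gcdl.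
have bE : b0 = b * d by rewrite divpK ?dvdp_gcdr.
have d0 : tofrac d != 0.
  by rewrite tofrac_eq0; apply: contra_neq b00 => d0; rewrite bE d0 mulr0.
have b_neq0 : tofrac b != 0.
  by rewrite tofrac_eq0; apply: contra_neq b00 => b_0; rewrite bE b_0 mul0r.
have yE : y = tofrac a / tofrac b.
  by rewrite yE0 aE bE !tofracM -mulf_div (divff d0) mulr1.
have /Bezout_coprimepP[[u v] /= /eqpP[[c c'] /= /andP[c0 c'0] E1]] : coprimep a b.
  by rewrite coprimep_div_gcd // b00 orbT.
have sI := submodule_scale (tofrac b) (submodule_self sP).
set I := [set x | _] in sI.
have iI : is_ideal P I.
  by case: sI => *; split=> // _ [z Pz ->]; apply: (sub_M sP).
have [[_ [w _ <-] wbE]|nI1] := pselect (I 1).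
  by exists (a * w); rewrite yE tofracM -[in LHS](mulr1 (_ / _)) wbE mulrCA (divfK b_neq0) mulrC.
have [U [vU PU IU]] := chevalley sP iI nI1.
have [sU _] := vU; have [_ ND NM] := nonunits_submodule vU.
have Nb : nonunits U (tofrac b).
  by apply: IU; exists 1; [exact: (sub_1 sP)|rewrite mul1r].
have Na : nonunits U (tofrac a).
  by rewrite -(divfK b_neq0 (tofrac a)) -yE; apply: NM => //; exact: Uy.
have Nc : nonunits U (tofrac c'%:P).
  rewrite -alg_polyC -E1 -mul_polyC tofracM; apply: (NM); first exact/PU/Pt.
  by rewrite tofracD !tofracM; apply: (ND); apply: (NM) => //; exact/PU/Pt.
case: (nonunits1 vU); rewrite -tofrac1.
have -> : 1 = c'^-1%:P * c'%:P by rewrite -polyCM mulVf.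
by rewrite tofracM; apply: (NM) => //; exact/PU/Pt.
Qed.

(** The reciprocal polynomial vanishes at the inverse of a root; this lets inverses of residues be
    treated like the residues themselves. *)
Lemma root_rev_sum (F : fieldType) (c : {poly F}) (a : F) : root c a -> a != 0 ->
  \sum_(i < size c) c`_(size c - i.+1) * a^-1 ^+ i = 0.
Proof.
move=> /rootP ca a0; set n := size c; apply: (mulfI (expf_neq0 n a0)).
transitivity (a * c.[a]); last by rewrite ca !mulr0.
rewrite horner_coef !mulr_sumr (reindex_inj rev_ord_inj) /=; apply: eq_bigr => i _.
rewrite subnSK ?ltn_ord // subKn 1?ltnW ?ltn_ord // mulrCA [RHS]mulrCA; congr (_ * _).
have {1}-> : n = (i.+1 + (n - i.+1))%N by rewrite subnKC.
by rewrite exprD exprVn mulfK ?expf_neq0 // exprS.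
Qed.

Lemma tofrac_polyC_sum (K : fieldType) n (c : nat -> K) (a : K) :
  \sum_(i < n) tofrac (c i)%:P * tofrac a%:P ^+ i = tofrac (\sum_(i < n) c i * a ^+ i)%:P.
Proof.
rewrite (raddf_sum (@polyC K)) (raddf_sum (@tofrac {poly K})); apply: eq_bigr => i _.
by rewrite /= polyCM tofracM polyC_exp tofracXn.
Qed.

Section Main.
Variables (K : fieldType) (D A : set K) (s : nat).
Hypothesis sD : is_subring D.
Hypothesis qD : quotient_field D = setT.
Hypothesis sA : is_subring A.
Hypothesis DA : D `<=` A.
Hypothesis cardE : maximal_ideals (integral_closure A) #= `I_s.
Hypothesis residues : forall M, maximal_ideal D M -> `I_s.+1 #<= residue_field D M.
Implicit Types (V I J M N P : set K) (a b d u : K) (f g h : {poly K}).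
Implicit Types (W : set {fraction {poly K}}) (x y z : {fraction {poly K}}).

Local Notation E := (integral_closure A).
Local Notation R := (kron D `&` nagata A).
Local Notation center V := (nonunits (nagata V) `&` R).
Local Notation loc V := (localize (A `&` V) (nonunits V `&` A)).

Let qA : quotient_field A = setT. Proof. exact: quotient_field_sub qD. Qed.
Let sE : is_subring E. Proof. exact: integral_closure_subring. Qed.
Let AE : A `<=` E. Proof. exact: sub_integral_closure. Qed.
Let DE : D `<=` E. Proof. exact: subset_trans AE. Qed.

(** Lying over: if [d] generated a proper ideal of [A], it would be a nonunit of some valuation ring
    above [A], which contains [E] and so [d^-1]. *)
Lemma integral_unit d : A d -> E d^-1 -> A d^-1.
Proof.
move=> Ad Ed; have [->|d0] := eqVneq d 0; first by rewrite invr0; exact: sub_0.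
have sI := submodule_scale d (submodule_self sA); set I := [set x | _] in sI.
have iI : is_ideal A I by case: sI => *; split=> // _ [c Ac ->]; exact: sub_M.
have [[c Ac E1]|nI1] := pselect (I 1).
  by suff <- : c = d^-1 by []; apply: (mulIf d0); rewrite -E1 mulVf.
have [V [vV AV IV]] := chevalley sA iI nI1.
have Vd : V d^-1 by move/(integral_closureP _ sA qA): Ed; exact.
have [/eqP|//] : nonunits V d by apply: IV; exists 1; [exact: sub_1|rewrite mul1r].
by rewrite (negPf d0).
Qed.

Lemma nagata_cap_valring V : valring V -> D `<=` V ->
  nagata A `&` nagata V `<=` nagata (A `&` V).
Proof.
move=> vV DV; exact: (nagata_capV sD residues sE DE cardE vV DV sA DA AE integral_unit).
Qed.

Lemma nagata_closure_cap_valring V : valring V -> D `<=` V ->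
  nagata E `&` nagata V `<=` nagata (E `&` V).
Proof.
move=> vV DV; exact: (nagata_capV sD residues sE DE cardE vV DV sE DE (@subset_refl _ _)).
Qed.

Lemma subringR : is_subring R.
Proof. by apply: subringI; [exact: kron_subring|exact: nagata_subring]. Qed.

Lemma R_frac f h : coefs_in A f -> coefs_in A h -> primitive A h ->
  (forall V, valring V -> D `<=` V -> content_le V f h) -> R (tofrac f / tofrac h).
Proof.
move=> Af Ah ph fh; split; first exact: kron_content (primitive_neq0 ph) fh.
by apply/nagataP => //; exists f, h.
Qed.

Lemma R_poly f : coefs_in D f -> R (tofrac f).
Proof.
move=> Df; split; last by apply: nagata_poly => //; exact: coefs_in_sub Df.
by move=> V [sV _] DV; apply: nagata_poly => //; exact: coefs_in_sub Df.
Qed.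

Lemma R_X : R (tofrac 'X).
Proof. by apply: R_poly; rewrite -['X]expr1; exact: coefsXn. Qed.

Lemma R_C a : D a -> R (tofrac a%:P).
Proof. by move=> Da; apply: R_poly; exact: (coefsC (submodule_self sD)). Qed.

(* Kronecker's trick: [h] has all coefficients of [f], [g] and [1], so [f / h] *)
(* and [g / h] lie in every Gauss extension and have a primitive denominator.  *)
Lemma R_common_denominator f g : coefs_in A f -> coefs_in A g -> exists h,
  [/\ forall B, primitive B h,
      forall J, J 0 -> J 1 -> coefs_in J f -> coefs_in J g -> coefs_in J h,
      R (tofrac f / tofrac h) & R (tofrac g / tofrac h)].
Proof.
move=> Af Ag; pose h := catp (catp f g) 1.
have hJ J : J 0 -> J 1 -> coefs_in J f -> coefs_in J g -> coefs_in J h.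
  move=> J0 J1 Jf Jg; apply/coefs_catp => //; split; first exact/coefs_catp.
  by move=> i; rewrite coef1; case: eqP.
have ph B : primitive B h.
  exact: primitive_content_le (@content_le_catr _ B _ _) (@primitive1 _ B).
have Ah : coefs_in A h by apply: hJ => //; [exact: sub_0|exact: sub_1].
exists h; split=> //; apply: R_frac => // V _ _.
  exact: content_le_trans (@content_le_catl _ V f g) (@content_le_catl _ V _ _).
exact: content_le_trans (@content_le_catr _ V f g) (@content_le_catl _ V _ _).
Qed.

Lemma R_quotient : quotient_field R = setT.
Proof.
apply/seteqP; split=> // x _; have [f [g [g0 ->]]] := fracP x.
have [b [b0 Ab Af Ag]] : exists b, [/\ b != 0, A b, coefs_in A (b *: f) & coefs_in A (b *: g)].
  have clear h : exists2 b, [set c | A c /\ c != 0] b & coefs_in A (b *: h).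
    apply: clear_denominators => //.
    - by move=> c [].
    - by split; [exact: sub_1|exact: oner_neq0].
    - by move=> c d [Ac c0] [Ad d0]; split; [exact: sub_M|exact: mulf_neq0].
    - move=> i; have [c [d [Ac Ad d0 ->]]] : quotient_field A h`_i by rewrite qA.
      by exists d; rewrite // mulrC divfK.
  have [b [Ab b0] Abf] := clear f; have [c [Ac c0] Acg] := clear g.
  exists (b * c); split; [exact: mulf_neq0|exact: sub_M| |].
    by move=> i; rewrite mulrC -scalerA coefZ; exact: sub_M.
  by move=> i; rewrite -scalerA coefZ; exact: sub_M.
have [h [ph _ Rf Rg]] := R_common_denominator Af Ag.
have h0 : tofrac h != 0 by rewrite tofrac_eq0 (primitive_neq0 (ph A)).
have bg0 : tofrac (b *: g) != 0 by rewrite tofrac_eq0 scale_poly_eq0 negb_or b0.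
exists (tofrac (b *: f) / tofrac h), (tofrac (b *: g) / tofrac h).
split; [exact: Rf|exact: Rg|exact: mulf_neq0 bg0 (invr_neq0 h0)|].
by rewrite (div_common_denominator _ _ h0) (tofrac_scale_div f g b0).
Qed.

(** * Localization at the center of a valuation ring *)

Section OneValring.
Variable V : set K.
Hypotheses (vV : valring V) (DV : D `<=` V).

Let sV : is_subring V. Proof. by case: vV. Qed.
Let sAV : is_subring (A `&` V). Proof. exact: subringI. Qed.

Lemma center_prime : prime_ideal (A `&` V) (nonunits V `&` A).
Proof.
have [N0 ND NM] := nonunits_submodule vV; split.
- split.
  + by move=> a [/(nonunits_sub vV)].
  + by split=> //; exact: sub_0.
  + by move=> a b [Na Aa] [Nb Ab]; split; [exact: ND|exact: sub_D].
  + by move=> a b [Aa Va] [Nb Ab]; split; [exact: NM|exact: sub_M].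
- by case=> /(nonunits1 vV).
- by move=> a b [Aa Va] [Ab Vb] [/(nonunits_prime vV Va Vb)[] N _]; [left|right].
Qed.

Lemma loc_subring : is_subring (loc V).
Proof. by apply: localize_subring; [exact: sAV|exact: center_prime]. Qed.

Lemma sub_loc : A `&` V `<=` loc V.
Proof. by apply: sub_localize; [exact: sAV|exact: center_prime]. Qed.

Lemma loc_inv a : A a -> V a -> ~ nonunits V a -> loc V a^-1.
Proof. by move=> Aa Va nNa; apply: localize_inv => // -[]. Qed.

Lemma loc_sub : loc V `<=` V.
Proof.
move=> _ [a [c [[Aa Va] [Ac Vc] nNc ->]]]; apply: sub_M => //.
by have /nonunitsN[] : ~ nonunits V c by move=> Nc; apply: nNc.
Qed.

Lemma R_cap x : R x -> nagata (A `&` V) x.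
Proof. by case=> Dx Ax; apply: nagata_cap_valring => //; split=> //; exact: Dx. Qed.

(** The ring lies in [(A /\ V)(t)] by [nagata_cap_valring], which gives one inclusion. Conversely,
    the denominators of [f] and [g] are cleared by an element that is a unit of [V], and both are
    then divided by the [h] of [R_common_denominator]. *)
Lemma localize_center : localize R (center V) = nagata (loc V).
Proof.
have sB := loc_subring; apply/seteqP; split=> [_ [y [z [Ry Rz nz ->]]]|].
  have [f [g [Ef Eg pg yE]]] := (nagataP y sAV).1 (R_cap Ry).
  have [f' [g' [Ef' Eg' pg' zE]]] := (nagataP z sAV).1 (R_cap Rz).
  have VE : A `&` V `<=` V by move=> a [].
  (* Outside the center, the numerator has a coefficient that is a unit of [V], hence invertible in
     [loc V]; so the numerator is primitive there and may become a denominator. *)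
  have /existsNP[i nNi] : ~ coefs_in (nonunits V) f'.
    move=> Nf'; apply: nz; split=> //; rewrite zE; apply/nonunits_nagata => //.
    - exact: coefs_in_sub Ef'.
    - exact: coefs_in_sub Eg'.
    - exact: primitive_sub pg'.
  have pf' : primitive (loc V) f'.
    move=> J [_ _ JM] Jf'; have /nonunitsN[fi0 _] := nNi.
    rewrite -(mulVf fi0); apply: JM => //; have [Ai Vi] := Ef' i.
    exact: loc_inv.
  have sn := nagata_subring sB; rewrite yE zE invf_div; apply: (sub_M sn).
    apply/nagataP => //; exists f, g.
    split=> //; [exact: coefs_in_sub sub_loc Ef|exact: coefs_in_sub sub_loc Eg|].
    exact: primitive_sub sub_loc pg.
  apply/nagataP => //; exists g', f'.
  by split=> //; [exact: coefs_in_sub sub_loc Eg'|exact: coefs_in_sub sub_loc Ef'].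
move=> x /(nagataP _ sB)[f [g [Bf Bg pg ->]]].
pose S := [set c | (A `&` V) c /\ ~ (nonunits V `&` A) c].
have pc := center_prime.
have S1 : S 1 by split; [exact: sub_1|case: pc].
have SM a b : S a -> S b -> S (a * b).
  move=> [Ea nPa] [Eb nPb]; split; [exact: sub_M|exact: (prime_complementM pc)].
have clear h : coefs_in (loc V) h -> exists2 b, S b & coefs_in (A `&` V) (b *: h).
  move=> Bh; apply: clear_denominators => //; first by move=> a [].
  move=> i; have [a [c [Ea Ec nPc ->]]] := Bh i; exists c => //.
  by rewrite mulrC divfK //; exact: (prime_complement_neq0 pc).
have [b Sb Ebf] := clear f Bf; have [c Sc Ecg] := clear g Bg.
have [Ed nPd] := SM _ _ Sb Sc; set d := b * c in Ed nPd.
have [Eb _] := Sb; have [Ec _] := Sc.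
have Ef : coefs_in (A `&` V) (d *: f).
  by move=> i; rewrite /d mulrC -scalerA coefZ; exact: sub_M.
have Eg : coefs_in (A `&` V) (d *: g).
  by move=> i; rewrite /d -scalerA coefZ; exact: sub_M.
have VE : A `&` V `<=` V by move=> a [].
have EA : A `&` V `<=` A by move=> a [].
have [h [ph hJ Rf Rg]] := R_common_denominator (coefs_in_sub EA Ef) (coefs_in_sub EA Eg).
have h0 : tofrac h != 0 by rewrite tofrac_eq0 (primitive_neq0 (ph A)).
have d0 : d != 0 by exact: (prime_complement_neq0 pc nPd).
have Vh : coefs_in V h.
  by apply: hJ; [exact: sub_0|exact: sub_1|exact: coefs_in_sub Ef|exact: coefs_in_sub Eg].
have Vdg := coefs_in_sub VE Eg.
have nNg : ~ coefs_in (nonunits V) (d *: g).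
  apply/(primitive_unit vV Vdg).
  apply: primitive_content_le (primitive_sub loc_sub pg) => J [_ _ JM] Jdg i.
  rewrite -(mulKf d0 g`_i); apply: JM; last by rewrite -coefZ.
  have [Ad Vd] := Ed.
  by have /nonunitsN[] : ~ nonunits V d by move=> Nd; apply: nPd.
exists (tofrac (d *: f) / tofrac h), (tofrac (d *: g) / tofrac h).
split; [exact: Rf|exact: Rg| |].
  by case=> /(nonunits_nagata vV Vdg Vh (ph V)).
by rewrite (div_common_denominator _ _ h0) (tofrac_scale_div f g d0).
Qed.

(** The products of elements of [V] and [A] form a ring, which must be all of [K]. Given [a = p / e]
    in [V] with [p], [e] in [D], this provides a unit [d2] of [A] with the same value as [e], and
    [a = (p / d2) / (e / d2)] is a fraction of the required kind. *)
Lemma no_common_overring_loc : no_common_proper_overring A V -> loc V = V.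
Proof.
move=> noC; apply/seteqP; split=> [|a Va]; first exact: loc_sub.
pose C := [set u | exists2 b, A b & exists2 c, V c & u = c * b].
have comb2 b b' : A b -> A b' -> exists d, [/\ A d,
    forall J, submodule D J -> J b -> J b' -> J d,
    forall J, submodule V J -> J d -> J b /\ J b'
    & (forall N, maximal_ideal E N -> N b -> N b' -> False) -> d != 0 /\ A d^-1].
  move=> Ab Ab'.
  have [d [Dd Vd Nd]] := unit_combination2 sD residues sE DE cardE vV DV (AE Ab) (AE Ab').
  have Ad : A d by apply: Dd => //; exact: submodule_sub DA (submodule_self sA).
  exists d; split=> // nN; have [N maxN /(Nd N maxN)[]|d0 Ed] := nonmaximal_unit sE (AE Ad).
    exact: nN.
  by split=> //; exact: integral_unit.
have AC : A `<=` C.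
  by move=> b Ab; exists b => //; exists 1; [exact: sub_1|rewrite mul1r].
have VC : V `<=` C.
  by move=> c Vc; exists 1; [exact: sub_1|exists c; rewrite ?mulr1].
have sC : is_subring C.
  apply/is_subringP; split; first by apply: AC; exact: sub_1.
    move=> _ _ [b Ab [c Vc ->]] [b' Ab' [c' Vc' ->]].
    (* Both [b] and [b'] are [V]-multiples of one [d] in [A], so a difference of products is again a
       single product. *)
    have [d [Ad _ Vd _]] := comb2 b b' Ab Ab'.
    have [|[e Ve bE] [e' Ve' bE']] := Vd _ (submodule_scale d (submodule_self sV)).
      by exists 1; [exact: sub_1|rewrite mul1r].
    exists d => //; exists (c * e - c' * e'); first by apply: sub_B => //; exact: sub_M.
    by rewrite bE bE'; ring.
  move=> _ _ [b Ab [c Vc ->]] [b' Ab' [c' Vc' ->]].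
  by exists (b * b'); [exact: sub_M|exists (c * c'); [exact: sub_M|rewrite mulrACA]].
have CT u : C u.
  apply: contrapT => nCu; apply: noC; exists C; split=> //.
  by rewrite qA; split=> // /(_ u); apply: contra_not nCu; apply.
have [p [e [Dp De e0 aE]]] : quotient_field D a by rewrite qD.
have [b Ab [c Vc eE]] := CT e^-1.
(* Pairing [b] with 1 makes [d1] a unit of [A] that divides [b] in [V]. As [e^-1 = c * b], it
   follows that [d1^-1] is a [V]-multiple of [e]. *)
have [d1 [Ad1 _ Vd1 Ud1]] := comb2 b 1 Ab (sub_1 sA).
have [N [_ nN1 _] _ /nN1//|d10 Ad1'] := Ud1.
have [|[c1 Vc1 bE] _] := Vd1 _ (submodule_scale d1 (submodule_self sV)).
  by exists 1; [exact: sub_1|rewrite mul1r].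
(* The unit [d1^-1] among the arguments makes [d2] a unit of [A]; since both arguments are
   [V]-multiples of [e], so is [d2], and [e] is one of [d2]. *)
have [d2 [Ad2 Dd2 Vd2 Ud2]] := comb2 e d1^-1 (DA De) Ad1'.
have [N [[_ _ _ NM] nN1 _] _ Nd|d20 Ad2'] := Ud2.
  by apply: nN1; rewrite -(mulfV d10); apply: NM => //; exact: AE.
have [c2 Vc2 d2E] : [set u | exists2 c, V c & u = c * e] d2.
  apply: Dd2; first exact: submodule_sub DV (submodule_scale e (submodule_self sV)).
    by exists 1; [exact: sub_1|rewrite mul1r].
  exists (c * c1); first exact: sub_M.
  by apply: (mulIf d10); rewrite mulVf // -mulrA -(mulfV e0) eE bE; ring.
have [|[c3 Vc3 eE3] _] := Vd2 _ (submodule_scale d2 (submodule_self sV)).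
  by exists 1; [exact: sub_1|rewrite mul1r].
have c3E : c3 = e / d2 by rewrite eE3 mulfK.
have c2E : c2 = (e / d2)^-1 by rewrite invf_div d2E mulfK.
exists (p / d2), (e / d2); split.
- split; first by apply: sub_M => //; exact: DA.
  have -> : p / d2 = a * (e / d2) by rewrite aE mulrA divfK.
  by apply: sub_M => //; rewrite -c3E.
- by split; [apply: sub_M => //; exact: DA|rewrite -c3E].
- case=> + _; apply/nonunitsN; rewrite -c2E; split=> //.
  by rewrite mulf_neq0 ?invr_eq0.
- by rewrite aE invf_div mulrA divfK.
Qed.

End OneValring.

(** * Proper ideals and the valuation rings above them *)

(** Over a common denominator, [x = f / h] and [y = g / h]. The element [x + t^(size f) * y] of [I]
    has numerator [catp f g], whose content contains those of [f] and [g] at every [V]; hence it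
    divides both in the Kronecker ring. *)
Lemma R_gcd (I : set {fraction {poly K}}) x y : is_ideal R I -> I x -> I y ->
  exists2 z, I z & exists x' y', [/\ kron D x', kron D y', x = x' * z & y = y' * z].
Proof.
case=> IR I0 ID IM Ix Iy.
have [a [b [b0 xE]]] := fracP x; have [c [e [e0 yE]]] := fracP y.
pose f := a * e; pose g := c * b; pose h := b * e.
have b0' : tofrac b != 0 by rewrite tofrac_eq0.
have e0' : tofrac e != 0 by rewrite tofrac_eq0.
have xE' : x = tofrac f / tofrac h.
  by rewrite xE !tofracM -mulf_div (divff e0') mulr1.
have yE' : y = tofrac g / tofrac h.
  by rewrite yE /h [b * e]mulrC !tofracM -mulf_div (divff b0') mulr1.
have [w0|w0] := eqVneq (catp f g) 0.
  have /coefs_catp[] : coefs_in [set 0] (catp f g) by move=> i; rewrite w0 coef0.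
    by [].
  move=> f0 g0; have f00 : f = 0 by apply/polyP => i; rewrite coef0; exact: f0.
  have g00 : g = 0 by apply/polyP => i; rewrite coef0; exact: g0.
  exists 0 => //; exists 0, 0; rewrite xE' yE' f00 g00 !tofrac0 !mul0r.
  by split=> //; exact: (sub_0 (kron_subring D)).
have w0' : tofrac (catp f g) != 0 by rewrite tofrac_eq0.
exists (tofrac (catp f g) / tofrac h).
  have -> : tofrac (catp f g) / tofrac h = x + tofrac 'X^(size f) * y.
    by rewrite xE' yE' mulrA -mulrDl -tofracM -tofracD.
  apply: ID => //; apply: IM => //; apply: R_poly; exact: coefsXn.
exists (tofrac f / tofrac (catp f g)), (tofrac g / tofrac (catp f g)).
rewrite xE' yE' !mulrA !(divfK w0'); split; try reflexivity.
- by apply: kron_content => // V _ _; exact: content_le_catl.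
- by apply: kron_content => // V _ _; exact: content_le_catr.
Qed.

(** Take [V] to be the trace of [W] on [K]. For primitive [g] each quotient [g_i / g] is in
    [kron D], so the constants [a] with [a / g] in [W] form a [V]-module containing the coefficients
    of [g], hence 1. Thus [1 / g] is in [W]. *)
Lemma kron_valring W : valring W -> kron D `<=` W -> exists V,
  [/\ valring V, D `<=` V & nagata V `<=` W].
Proof.
move=> vW kW; have [sW _] := vW; have vV := constants_valring vW.
have DV : D `<=` constants W.
  by move=> a Da; apply: kW; case: (R_C Da).
exists (constants W); split=> // x; have [sV _] := vV.
move=> /(nagataP _ sV)[f [g [Vf Vg pg ->]]].
have WX : W (tofrac 'X) by apply: kW; case: R_X.
apply: sub_M => //; first exact: (submodule_tofrac sW (submodule_self sW)).
pose J := [set a | W (tofrac a%:P / tofrac g)].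
suff : J 1 by rewrite /J /= tofrac1 div1r.
apply: (pg).
  rewrite /J; split=> /=; first by rewrite tofrac0 mul0r; exact: sub_0.
    by move=> a b Wa Wb; rewrite polyCD tofracD mulrDl; exact: sub_D.
  by move=> a b Wa Wb; rewrite polyCM tofracM -mulrA; exact: sub_M.
move=> i; apply: kW; apply: kron_content; first exact: (primitive_neq0 pg).
by move=> V _ _ J' sJ' Jg; exact: (coefsC sJ').
Qed.

(** If [I] extends to a proper ideal of [kron D], Chevalley's theorem and [kron_valring] supply [V].
    Otherwise some [m] in [I] is a unit of [kron D], and then also of [R], contradicting that [I] is
    proper. *)
Lemma proper_ideal_center (I : set {fraction {poly K}}) :
  is_ideal R I -> ~ I 1 -> exists V,
  [/\ valring V, D `<=` V & I `<=` nonunits (nagata V)].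
Proof.
move=> iI nI1; have [IR I0 ID IM] := iI; have sk := kron_subring D.
pose J := [set x | exists2 m, I m & exists2 z, kron D z & x = z * m].
have IJ : I `<=` J by move=> m Im; exists m => //; exists 1; [exact: (sub_1 sk)|rewrite mul1r].
have iJ : is_ideal (kron D) J.
  split.
  - move=> _ [m /IR[km _] [z kz ->]]; exact: (sub_M sk).
  - exact: IJ.
  - move=> _ _ [m Im [z kz ->]] [m' Im' [z' kz' ->]].
    have [w Iw [u [v [ku kv -> ->]]]] := R_gcd iI Im Im'.
    exists w => //; exists (z * u + z' * v); last by rewrite mulrDl !mulrA.
    by apply: (sub_D sk) => //; exact: (sub_M sk).
  - move=> z' _ kz' [m Im [z kz ->]]; exists m => //; exists (z' * z); first exact: (sub_M sk).
    by rewrite mulrA.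
have [[m Im [z kz zmE]]|nJ1] := pselect (J 1); last first.
  have [U [vU kU JU]] := chevalley sk iJ nJ1.
  have [V [vV DV VU]] := kron_valring vU kU; exists V; split=> // m Im.
  apply: contrapT => /nonunitsN[m0 Vm]; have : ~ nonunits U m.
    by apply/nonunitsN; split=> //; exact: VU.
  by apply; exact/JU/IJ.
(* Write [m = f / g] with [g] primitive over [A]. If [f] were not primitive, its coefficients would
   be nonunits of some [V] above [A]; as [g / f] is in [V(t)], so would those of [g]. *)
have Rm := IR _ Im; have [_ /(nagataP _ sA)[f [g [Af Ag pg mE]]]] := Rm.
have m0 : m != 0 by apply/eqP => m0; move/eqP: zmE; rewrite m0 mulr0 oner_eq0.
have zE : z = m^-1 by apply: (mulIf m0); rewrite -zmE mulVf.
have f0 : f != 0.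
  by apply: contra_neq m0 => f0; rewrite mE f0 tofrac0 mul0r.
case: nI1; rewrite zmE zE; apply: IM => //; split; first by rewrite -zE.
apply/nagataP => //; exists g, f; rewrite mE invf_div; split=> // J' sJ' J'f.
apply: contrapT => nJ'1.
have [|V [vV AV J'V]] := chevalley sA (ideal_submoduleI sA sJ'); first by case.
have DV : D `<=` V by exact: subset_trans AV.
have := kz V vV DV; rewrite zE mE invf_div => /(nagata_content vV _ f0) gf.
apply: (nonunits1 vV); apply: (primitive_sub AV pg) (nonunits_submodule vV) _.
by apply: gf (nonunits_submodule vV) _ => i; apply: J'V.
Qed.

Lemma center_ideal V : valring V -> D `<=` V -> is_ideal R (center V) /\ ~ center V 1.
Proof.
move=> vV DV; have vN := nagata_valring vV; split; last by case=> /(nonunits1 vN).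
rewrite [center V]setIC; apply: (ideal_submoduleI subringR).
apply: submodule_sub (nonunits_submodule vN) => x [kx _]; exact: kx.
Qed.

Lemma maximal_ideal_center (M : set {fraction {poly K}}) : maximal_ideal R M -> exists V,
  [/\ valring V, D `<=` V & M = center V].
Proof.
move=> [iM nM1 maxM]; have [V [vV DV MV]] := proper_ideal_center iM nM1.
have [iC nC1] := center_ideal vV DV.
exists V; split=> //; apply/esym/maxM => // x Mx; split; first exact: MV.
by case: iM => + _ _ _; apply.
Qed.

Lemma nagata_loc_sub W V : valring W -> R `<=` W -> valring V -> D `<=` V ->
  nonunits W `&` R `<=` nonunits (nagata V) -> nagata (loc V) `<=` W.
Proof.
move=> vW RW vV DV NWV; have [sW _] := vW.
rewrite -(localize_center vV DV) => _ [y [z [Ry Rz nz ->]]].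
apply: sub_M => //; first exact: RW.
have /nonunitsN[] // : ~ nonunits W z.
by move=> Nz; apply: nz; split=> //; exact: NWV.
Qed.

(** Both [W] and [V(t)] dominate the localization of [R] at their common center, which is
    [nagata (loc V)]; so their nonunits agree on it. *)
Lemma nonunits_dominating W V x : valring W -> R `<=` W -> valring V -> D `<=` V ->
  nonunits W `&` R = center V -> nagata (loc V) x ->
  nonunits W x <-> nonunits (nagata V) x.
Proof.
move=> vW RW vV DV NWV; rewrite -(localize_center vV DV) => -[y [z [Ry Rz nz ->]]].
have RV : R `<=` nagata V by move=> u [ku _]; exact: ku.
have vN := nagata_valring vV.
have quot (U : set {fraction {poly K}}) : valring U -> R `<=` U -> nonunits U `&` R = center V ->
    nonunits U (y / z) <-> center V y.
  move=> vU RU NU; have [_ _ NM] := nonunits_submodule vU.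
  have /nonunitsN[z0 Uz] : ~ nonunits U z by move=> Nz; apply: nz; rewrite -NU.
  rewrite -NU; split=> [Nyz|[Ny _]]; last by rewrite mulrC; exact: NM.
  by split=> //; rewrite -(divfK z0 y) mulrC; apply: NM => //; exact: RU.
by rewrite (quot W) // (quot (nagata V)).
Qed.

(** * The integral closure *)

(** A primitive [g] clears the denominators of the monic equation of [x], leaving leading
    coefficient [g]. So [g * x] lies in every valuation ring over [A[t]]: it is a polynomial, and
    its coefficients are integral over [A], as seen in the rings [V(t)]. *)
Lemma integral_nagata x : integral_over (nagata A) x -> nagata E x.
Proof.
move=> [p [/monicP lp /(polyOver_coefs (nagata_subring sA)) Ap px]].
pose AX := [set tofrac f | f in coefs_in A].
have sAX : is_subring AX by exact: tofrac_image_subring.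
have [||||_ [g [Ag pg] <-] AXg] :=
    @clear_denominators _ AX [set tofrac g | g in [set g | coefs_in A g /\ primitive A g]] p sAX.
- by move=> _ [g [Ag _] <-]; exists g.
- by exists 1; [split; [exact: coefs1|exact: primitive1]|exact: tofrac1].
- move=> _ _ [g [Ag pg] <-] [g' [Ag' pg'] <-]; exists (g * g'); last exact: tofracM.
  by split; [exact: (coefsM sA (submodule_self sA))|exact: primitiveM].
- move=> i; have /(nagataP _ sA)[f [g [Af Ag pg ->]]] := Ap i.
  have g0 : tofrac g != 0 by rewrite tofrac_eq0 (primitive_neq0 pg).
  by exists (tofrac g); [exists g|exists f; rewrite // mulrC (divfK g0)].
have g0 : tofrac g != 0 by rewrite tofrac_eq0 (primitive_neq0 pg).
have Ux W : valring W -> AX `<=` W -> W (tofrac g * x).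
  move=> vW AXW; have Wp := coefs_in_sub AXW AXg.
  have := lead_coef_mul_root vW Wp; rewrite lead_coefZ lp mulr1; apply.
  by rewrite rootZ.
have [|q qE] := @polynomial_integrally_closed K (tofrac g * x).
  move=> W vW PW; apply: Ux => // _ [f _ <-]; apply: PW.
  by exists f.
have Eq : coefs_in E q.
  move=> i; apply/(integral_closureP _ sA qA) => V vV AV; have [sV _] := vV.
  have : nagata V (tofrac q / tofrac 1).
    rewrite tofrac1 divr1 -qE; apply: Ux; first exact: nagata_valring.
    by move=> _ [f Af <-]; apply: nagata_poly => //; exact: coefs_in_sub Af.
  move=> /(nagata_content vV _ (oner_neq0 _)) q1.
  exact: q1 (submodule_self sV) (coefs1 sV) i.
apply/(nagataP _ sE); exists q, g; split.
- exact: Eq.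
- exact: coefs_in_sub Ag.
- exact: primitive_sub pg.
- by rewrite -qE mulrC (mulKf g0).
Qed.

(** A monic equation over [A] is primitive, so it can be divided by the [d] of
    [primitive_combination]. The coefficients then lie in [V], and not all are nonunits because [d]
    is a [D]-combination of the old ones. *)
Lemma residue_algebraic V a : valring V -> D `<=` V -> E a -> exists c : {poly K},
  [/\ coefs_in (A `&` V) c, ~ coefs_in (nonunits V) c & root c a].
Proof.
move=> vV DV [_ [p [/monicP lp /(polyOver_coefs sA) Ap pa]]]; have [sV _] := vV.
have pp : primitive A p by move=> J _ Jp; rewrite -lp; exact: Jp.
have [d [d0 Ad Ad' Dd Vd]] := primitive_combination sD residues sE DE cardE vV DV
  sA DA AE integral_unit Ap pp.
exists (d^-1 *: p); split; last by rewrite rootZ // invr_eq0.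
  move=> i; rewrite coefZ; split; first exact: sub_M.
  have [|c Vc ->] := Vd _ (submodule_scale d (submodule_self sV)) _ i.
    by exists 1; [exact: sub_1|rewrite mul1r].
  by rewrite mulrC mulfK.
move=> Np; have sN := submodule_sub DV (submodule_scale d (nonunits_submodule vV)).
have [|c Nc dE] := Dd _ sN.
  by move=> i; exists (d^-1 *: p)`_i => //; rewrite coefZ mulrAC mulVf // mul1r.
by apply: (nonunits1 vV); suff <- : c = 1 by []; apply: (mulIf d0); rewrite -dE mul1r.
Qed.

(* [E] is integral over [A], so the residue field of [V] restricted to [E] is *)
(* algebraic over that of [loc V].                                           *)
Lemma valring_residue_closure W U a : valring W -> R `<=` W -> D `<=` constants W ->
  valring U -> nonunits W `<=` U -> loc (constants W) `<=` constants U ->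
  E a -> constants W a ->
  U (tofrac a%:P) /\ (~ nonunits (constants W) a -> U (tofrac a%:P)^-1).
Proof.
set V := constants W => vW RW DV vU NU BU Ea Va.
have vV : valring V by exact: constants_valring.
have [c [AVc nNc ca]] := residue_algebraic vV DV Ea.
have Uc i : U (tofrac (c`_i)%:P) by apply: BU; exact: sub_loc.
have Ucv i : nonunits W (tofrac (c`_i)%:P) \/ U (tofrac (c`_i)%:P)^-1.
  have [Nc|nNci] := pselect (nonunits V c`_i).
    by left; move: Nc; rewrite nonunits_constants.
  right; rewrite -tofrac_polyCV; apply: BU; have [Ac Vc] := AVc i.
  exact: loc_inv.
have [i0 lt_i0 nNi0] : exists2 i, (i < size c)%N & ~ nonunits W (tofrac (c`_i)%:P).
  have /existsNP[i nNi] := nNc; exists i; last by move: nNi; rewrite nonunits_constants.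
  by rewrite ltnNge; apply/negP => /(nth_default 0) ci; apply: nNi; rewrite ci; left.
split=> [|nNa].
  apply: (valring_top_coef (c := fun i => tofrac (c`_i)%:P) (n := size c) vU vW NU) => //.
    by exists i0.
  have /= -> := tofrac_polyC_sum (size c) (nth 0 c) a.
  by rewrite -horner_coef (rootP ca) tofrac0; left.
(* The same argument for [a^-1], with the coefficients in reverse order. *)
have /nonunitsN[a0 Va'] := nNa; rewrite -tofrac_polyCV.
apply: (valring_top_coef (c := fun i => tofrac (c`_(size c - i.+1))%:P) (n := size c) vU vW NU) => //.
  exists (size c - i0.+1)%N; first by rewrite ltn_subrL (leq_ltn_trans _ lt_i0).
  by rewrite subnSK // subKn // ltnW.
have /= -> := tofrac_polyC_sum (size c) (fun i => c`_(size c - i.+1)) a^-1.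
by rewrite (root_rev_sum ca a0) tofrac0; left.
Qed.

(** It suffices that a primitive [g] over [E /\ V] is not a nonunit of [W]. Otherwise [t] would be
    algebraic modulo the nonunits over residues that are themselves algebraic over the residue field
    of [loc V], whereas [gauss] says that [t] is transcendental over the latter. *)
Lemma dominating_gauss W : valring W -> R `<=` W ->
  nonunits W `&` R = center (constants W) -> D `<=` constants W ->
  nagata E `&` nagata (constants W) `<=` W.
Proof.
set V := constants W => vW RW NWV DV; have [sW _] := vW.
have vV : valring V by exact: constants_valring.
have [sV _] := vV; have sB := loc_subring vV.
have BV : loc V `<=` V by exact: loc_sub.
have sN := nonunits_submodule vW; have [N0 ND NM] := sN.
have WX : W (tofrac 'X) by apply: RW; exact: R_X.
have sEV : is_subring (E `&` V) by exact: subringI.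
have gauss G : coefs_in (loc V) G -> nonunits W (tofrac G) -> coefs_in (nonunits V) G.
  move=> BG NG; have /(nonunits_dominating vW RW vV DV NWV) : nagata (loc V) (tofrac G).
    exact: nagata_poly.
  move=> [/(_ NG)]; rewrite -[tofrac G]divr1 -tofrac1.
  by move=> /(nonunits_nagata vV (coefs_in_sub BV BG) (coefs1 sV) (@primitive1 _ _)).
(* [S] is [loc V + m_W], the preimage in [W] of the residue field of [loc V]; integrality over [S]
   replaces algebraicity over that field. *)
pose S := [set x | exists b, loc V b /\ nonunits W (x - tofrac b%:P)].
have WS x : S x -> W x.
  move=> [b [Bb Nx]]; rewrite -[x](subrK (tofrac b%:P)); apply: sub_D => //.
    exact: nonunits_sub.
  exact: BV.
have NS : nonunits W `<=` S.
  by move=> x Nx; exists 0; rewrite tofrac0 subr0; split=> //; exact: (sub_0 sB).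
have BS b : loc V b -> S (tofrac b%:P) by move=> Bb; exists b; rewrite subrr.
have sS : is_subring S.
  apply/is_subringP; split; first by rewrite -tofrac1; apply: BS; exact: (sub_1 sB).
  - move=> x y [b [Bb Nx]] [c [Bc Ny]]; exists (b - c); split; first exact: (sub_B sB).
    rewrite polyCB tofracB.
    have -> : x - y - (tofrac b%:P - tofrac c%:P) = (x - tofrac b%:P) - (y - tofrac c%:P).
      by rewrite !opprB addrACA [RHS]addrACA [- y + _]addrC.
    exact: (submodule_B sW sN).
  - move=> x y Sx Sy; have Wx := WS x Sx; case: Sx Sy => b [Bb Nx] [c [Bc Ny]].
    exists (b * c); split; first exact: (sub_M sB).
    rewrite polyCM tofracM.
    have -> : x * y - tofrac b%:P * tofrac c%:P
        = x * (y - tofrac c%:P) + tofrac c%:P * (x - tofrac b%:P).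
      by rewrite !mulrBr [tofrac c%:P * x]mulrC addrA subrK [tofrac c%:P * _]mulrC.
    by apply: (ND); apply: (NM) => //; exact: BV.
move=> x [Ex Vx]; have /(nagataP _ sEV)[f [g [EVf EVg pg ->]]] :=
  nagata_closure_cap_valring vV DV (conj Ex Vx).
have EVV : E `&` V `<=` V by move=> a [].
have Wf h : coefs_in (E `&` V) h -> W (tofrac h).
  move=> EVh; apply: (submodule_tofrac sW (submodule_self sW) WX).
  by move=> i; case: (EVh i).
suff /nonunitsN[_ Wg] : ~ nonunits W (tofrac g) by apply: sub_M => //; exact: Wf.
move=> Ng; have intX : integral_over S (tofrac 'X).
  apply/(integral_overP _ sS) => U vU SU.
  have NU : nonunits W `<=` U by exact: subset_trans SU.
  have BU : loc V `<=` constants U by move=> b /BS; exact: SU.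
  have res i := valring_residue_closure vW RW DV vU NU BU (EVg i).1 (EVg i).2.
  apply: (valring_top_coef (c := fun i => tofrac (g`_i)%:P) (n := size g) vU vW NU WX).
  - by move=> i _; case: (res i).
  - move=> i _; have [_ Ui] := res i; have [Ni|/Ui] := pselect (nonunits V g`_i).
      by left; move: Ni; rewrite nonunits_constants.
    by right.
  - have /(primitive_unit vV (coefs_in_sub EVV EVg))/existsNP[i nNi] := primitive_sub EVV pg.
    exists i; last by move: nNi; rewrite nonunits_constants.
    by rewrite ltnNge; apply/negP => /(nth_default 0) ci; apply: nNi; rewrite ci; left.
  - have -> : \sum_(i < size g) tofrac (g`_i)%:P * tofrac 'X ^+ i = tofrac g.
      rewrite -[in RHS](coefK g) poly_def rmorph_sum; apply: eq_bigr => i _.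
      by rewrite /= -mul_polyC tofracM tofracXn.
    exact: Ng.
have [p [/monicP lp /(polyOver_coefs sS) Sp /rootP pX]] := intX.
have /choice[b Pb] : forall i, exists b, loc V b /\ nonunits W (p`_i - tofrac b%:P).
  by move=> i; exact: Sp.
(* The monic relation for [t] over [S], lifted to [loc V]. Its value is a nonunit of [W], so [gauss]
   makes all its coefficients nonunits, although the top one is 1 modulo nonunits. *)
pose G := \poly_(i < size p) b i.
have BG : coefs_in (loc V) G.
  move=> i; rewrite coef_poly; case: ifP => _; last exact: (sub_0 sB).
  by case: (Pb i).
have NG : nonunits W (tofrac G).
  have -> : tofrac G = - \sum_(i < size p) (p`_i - tofrac (b i)%:P) * tofrac 'X ^+ i.
    have -> : tofrac G = \sum_(i < size p) tofrac (b i)%:P * tofrac 'X ^+ i.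
      rewrite /G poly_def rmorph_sum; apply: eq_bigr => i _.
      by rewrite /= -mul_polyC tofracM tofracXn.
    apply/eqP; rewrite -subr_eq0 opprK -big_split /=.
    rewrite -[X in _ == X]pX horner_coef; apply/eqP; apply: eq_bigr => i _.
    by rewrite -mulrDl addrC subrK.
  apply: (submodule_N sW sN); apply: (submodule_sum sN) => i _.
  by rewrite mulrC; apply: (NM); [exact: sub_X|case: (Pb i)].
have size_p : (0 < size p)%N.
  rewrite lt0n size_poly_eq0; apply/eqP => p0; move/eqP: lp.
  by rewrite p0 lead_coef0 eq_sym oner_eq0.
apply: (nonunits1 vW); have [_ Nb] := Pb (size p).-1.
rewrite -lead_coefE lp in Nb; rewrite -[1](subrK (tofrac (b (size p).-1)%:P)).
apply: (ND) => //; have := gauss G BG NG (size p).-1.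
by rewrite coef_poly prednK // leqnn nonunits_constants.
Qed.

(** Shrink [W] to a ring [W'] centered on a maximal ideal, which is the center of some [V0(t)].
    Since [V0] need not be the trace [V] of [W'] on [K], the center of [V] must be shown to be the
    same ideal before [dominating_gauss] applies. *)
Lemma integral_closure_sub_valring W : valring W -> R `<=` W ->
  kron D `&` nagata E `<=` W.
Proof.
move=> vW0 RW0; have [W' [vW RW W'W _ maxW]] := valring_dominating subringR vW0 RW0.
apply: subset_trans W'W.
have [V0 [vV0 DV0 NV0]] := maximal_ideal_center maxW.
pose V := constants W'; have vV : valring V by exact: constants_valring.
have [sV _] := vV; have [sV0 _] := vV0.
have DV : D `<=` V by move=> a Da; apply: RW; exact: R_C.
have AV0W : nagata (loc V0) `<=` W'.
  by apply: nagata_loc_sub => //; rewrite NV0 => x [].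
have sB0 := loc_subring vV0.
have AV0V : A `&` V0 `<=` V.
  move=> a AVa; apply: AV0W; apply: nagata_poly => //.
  by apply: (coefsC (submodule_self sB0)); exact: sub_loc.
have NV0V a : A a -> nonunits V0 a -> nonunits V a.
  move=> Aa Na; have V0a := nonunits_sub vV0 Na.
  have B0a : coefs_in (loc V0) a%:P.
    by apply: (coefsC (submodule_self sB0)); exact: sub_loc.
  rewrite nonunits_constants.
  apply/(nonunits_dominating vW RW vV0 DV0 NV0); first exact: nagata_poly.
  rewrite -[tofrac _]divr1 -tofrac1; apply/(nonunits_nagata vV0).
  - exact: (coefsC (submodule_self sV0)).
  - exact: coefs1.
  - exact: primitive1.
  - exact: (coefsC (nonunits_submodule vV0)).
(* Because [A /\ V0] lies in [V] and nonunits of [V0] in [A] are nonunits of [V], the center of [V0]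
   lies in that of [V]; maximality gives equality. *)
have NWV : nonunits W' `&` R = center V.
  have [iM nM1 maxM] := maxW; have [iC nC1] := center_ideal vV DV.
  apply/esym/maxM => // x Mx; have [_ Rx] := Mx; split=> //.
  have sAV0 : is_subring (A `&` V0) by exact: subringI.
  have [f [g [Ef Eg pg xE]]] := (nagataP x sAV0).1 (R_cap vV0 DV0 Rx).
  move: Mx; rewrite NV0 xE => -[Nx _].
  have V0E : A `&` V0 `<=` V0 by move=> a [].
  have Nf := (nonunits_nagata vV0 (coefs_in_sub V0E Ef) (coefs_in_sub V0E Eg)
    (primitive_sub V0E pg)).1 Nx.
  apply/(nonunits_nagata vV).
  - exact: coefs_in_sub Ef.
  - exact: coefs_in_sub Eg.
  - exact: primitive_sub pg.
  - by move=> i; apply: NV0V => //; case: (Ef i).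
move=> x [kx Ex]; apply: (dominating_gauss vW RW NWV DV); split=> //.
exact: kx.
Qed.

End Main.

Theorem theorem5p15 (K : fieldType) (D A : set K) (s : nat)
  (hD : is_subring D) (hK : quotient_field D = setT)
  (dimD : finite_krull_dim D) (dimA : finite_krull_dim A)
  (dimV : forall V, valuation_overring D V -> finite_krull_dim V)
  (hA : overring D A) (slA : semilocal A)
  (hDA : D = integral_closure D `&` A)
  (hs : maximal_ideals (integral_closure A) #= `I_s)
  (hres : forall M, maximal_ideal D M -> `I_s.+1 #<= residue_field D M) :
  let R' := kronecker (integral_closure D) `&` nagata A in
  [/\ (* (i) *)
      forall V, valuation_overring D V ->
        let p := max_ideal (nagata V) `&` R' in
        localize R' p = nagata (localize (A `&` V) (max_ideal V `&` A)) /\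
        (no_common_proper_overring A V -> localize R' p = nagata V),
      (* (ii) *)
      forall W, valuation_overring R' W ->
        exists V, valuation_overring D V /\ nagata (A `&` V) `<=` W,
      (* (iii) *)
      forall M, maximal_ideal R' M ->
        exists C, overring D C /\ localize R' M = nagata C
    & (* (iv) *)
      integral_closure R' =
        kronecker (integral_closure D) `&` nagata (integral_closure A)].
Proof.
have [sA DA _] := hA; rewrite kroneckerE //=.
have sR := subringR D sA; have qR := R_quotient hK sA DA.
have sE : is_subring (integral_closure A).
  exact: integral_closure_subring sA (quotient_field_sub DA hK).
split.
- move=> V /(valuation_overringE _ hD hK)[vV DV].
  rewrite (max_idealE vV) (max_idealE (nagata_valring vV)).
  have locE := localize_center hD hK sA DA hs hres vV DV.
  by split=> // noC; rewrite locE (no_common_overring_loc hD hK sA DA hs hres vV DV noC).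
- move=> W /(valuation_overringE _ sR qR)[vW RW].
  (* The center of [W] on the ring is a proper ideal, hence contained in the center of some [V(t)];
     elements outside the latter are units of [W]. *)
  have [||V [vV DV NWV]] := @proper_ideal_center _ D A hD sA DA (nonunits W `&` (kron D `&` nagata A)).
  + rewrite [nonunits W `&` _]setIC; apply: (ideal_submoduleI sR).
    exact: submodule_sub RW (nonunits_submodule vW).
  + by case=> /(nonunits1 vW).
  exists V; split; first exact/valuation_overringE.
  have [sV _] := vV.
  apply: subset_trans (nagata_loc_sub hD hK sA DA hs hres vW RW vV DV NWV).
  apply: nagata_sub; [exact: subringI|exact: loc_subring|exact: sub_loc].
- move=> M /(maximal_ideal_center hD sA DA)[V [vV DV ->]].
  exists (localize (A `&` V) (nonunits V `&` A)).
  rewrite (localize_center hD hK sA DA hs hres vV DV); split=> //.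
  have [sV _] := vV; split; last by rewrite hK.
    exact: loc_subring.
  by move=> a Da; apply: sub_loc => //; split; [exact: DA|exact: DV].
- apply/seteqP; split=> x.
    move=> /(integral_closureP _ sR qR) Rx; split.
      (* Each [V(t)] is itself a valuation ring above the ring, so it contains every integral
         element. *)
      by move=> V vV DV; apply: Rx; [exact: nagata_valring|move=> y [ky _]; exact: ky].
    apply: (integral_nagata hK sA DA); apply/(integral_overP _ (nagata_subring sA)).
    by move=> W vW AW; apply: Rx => //; apply: subset_trans AW => y [].
  move=> Ex; apply/(integral_closureP _ sR qR) => W vW RW.
  exact: (integral_closure_sub_valring hD hK sA DA hs hres vW RW).
Qed.
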